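(* Let $\gamma<1$ and let $\alpha,\beta\ge\frac12$. For every $N\ge1$ let $-1=x_0<x_1<\dots<x_N=1$ be a set of nodes (depending on $N$), and let $R_N\in\mathbb{R}^{(N+1)\times N}$ be the matrix $$[R_N]_{k+1,j}=\frac{2}{j+\alpha+\beta+1}P_j^{(\alpha,\beta)}(x_k)\,\omega_{\alpha,\beta}(x_k),\quad k=0,\dots,N,\ j=1,\dots,N.$$ Then $\{N^\gamma R_N\}_N$ is a zero-distributed sequence, namely $$\{N^\gamma R_N\}_N\sim_\sigma0 .$$
   Context: For $\alpha,\beta>-1$, $\omega_{\alpha,\beta}(t)=(1-t)^\alpha(1+t)^\beta$ on $[-1,1]$, and $P_j^{(\alpha,\beta)}$ is the Jacobi polynomial of degree $j$, orthogonal on $[-1,1]$ with respect to $\omega_{\alpha,\beta}$, with the standard normalization $P_j^{(\alpha,\beta)}(1)=\frac{\Gamma(j+\alpha+1)}{\Gamma(j+1)\Gamma(\alpha+1)}$. A sequence of matrices $Z_N\in\mathbb{C}^{m_N\times n_N}$ with $d_N=\min\{m_N,n_N\}\to\infty$ is zero-distributed, written $\{Z_N\}_N\sim_\sigma0$, if $\lim_{N\to\infty}\frac1{d_N}\sum_{i=1}^{d_N}F(\sigma_i(Z_N))=F(0)$ for every $F\in C_c(\mathbb{R})$, where $\sigma_1(Z_N)\ge\dots\ge\sigma_{d_N}(Z_N)$ are the singular values; equivalently, for every $\varepsilon>0$, $\lim_{N\to\infty}\frac1{d_N}\#\{i\in\{1,\dots,d_N\}:\sigma_i(Z_N)>\varepsilon\}=0$.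 *)

(* Defs.v *)
From HB Require Import structures.
From mathcomp Require Import all_boot all_order all_algebra.
From mathcomp Require Import spectral.
From mathcomp Require Import all_classical all_reals all_analysis.
From mathcomp Require Import complex.

Set Implicit Arguments.
Unset Strict Implicit.
Unset Printing Implicit Defensive.

Import Order.TTheory GRing.Theory Num.Theory.
Import numFieldNormedType.Exports.

Local Open Scope classical_set_scope.
Local Open Scope ring_scope.
Local Open Scope sesquilinear_scope.

(* R[i] with its structure of numClosedFieldType named explicitly, which is the
   key under which the topology given by the modulus is found. *)
Definition Cplx (R : realType) : numClosedFieldType := R[i].

(* Euler's integral, which converges for s > 0. *)
Definition Gamma (R : realType) (s : R) : R :=
  \int[lebesgue_measure]_(t in `]0, +oo[) (t `^ (s - 1) * expR (- t)).

Definition jacobi_weight (R : realType) (a b t : R) : R :=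
  (1 - t) `^ a * (1 + t) `^ b.

(* For a, b > -1 there is exactly one such family P: the degrees and the
   orthogonality relations fix each P j up to a nonzero factor, and the
   normalization at 1 fixes that factor. *)
Definition is_jacobi (R : realType) (a b : R) (P : nat -> {poly R}) : Prop :=
  [/\ forall j, size (P j) = j.+1,
      forall i j, i <> j ->
        \int[lebesgue_measure]_(t in `[(-1 : R), 1])
          ((P i).[t] * (P j).[t] * jacobi_weight a b t) = 0
    & forall j, (P j).[1] =
        Gamma (j%:R + a + 1) / (Gamma (j%:R + 1) * Gamma (a + 1))].

(* The singular values, in nonincreasing order and with multiplicity: the
   square roots of the min(m, n) largest of the n eigenvalues of A^* A, all of
   which are nonnegative reals.  As A^* A is normal, the entries of its
   spectral_diag are its eigenvalues. *)
Definition singular_values (R : realType) (m n : nat) (A : 'M[Cplx R]_(m, n)) :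
    seq R :=
  take (minn m n)
    (sort >=%R
      [seq Num.sqrt (complex.Re (spectral_diag (A^t* *m A) ord0 i))
         | i <- enum 'I_n]).

(* Test functions are complex-valued, so C_c contains the real-valued ones via
   the embedding of R in C. *)
Definition Cc (R : realType) : set (R -> Cplx R) :=
  [set F : R -> Cplx R | continuous F /\ compact (closure [set x | F x != 0])].

Definition zero_distributed (R : realType) (m n : nat -> nat)
    (Z : forall N, 'M[Cplx R]_(m N, n N)) : Prop :=
  (fun N => minn (m N) (n N)) @ \oo --> \oo /\
  forall F : R -> Cplx R, Cc F ->
    (fun N => (minn (m N) (n N))%:R^-1 *
              \sum_(s <- singular_values (Z N)) F s) @ \oo --> F 0.

Definition jacobi_matrix (R : realType) (a b : R) (P : nat -> {poly R})
    (N : nat) (x : 'I_N.+1 -> R) : 'M[R]_(N.+1, N) :=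
  \matrix_(k < N.+1, j < N)
    (* the column index j of the matrix is 1-based in the formula *)
    (2 / (j.+1%:R + a + b + 1) * (P j.+1).[x k] * jacobi_weight a b (x k)).

(* Main.v *)
Require Import Defs.
From HB Require Import structures.
From mathcomp Require Import all_boot all_order all_algebra.
From mathcomp Require Import spectral.
From mathcomp Require Import all_classical all_reals all_analysis.
From mathcomp Require Import complex.
From mathcomp Require Import ring lra.

(** Write w = (1-x)^a (1+x)^b, s = a + b, and let P_n be the Jacobi polynomials.

    Everything rests on the uniform bound (w P_n)^2 <= K / (n+1) on [-1, 1]
    (is_jacobi_bound).  Granted it, the entries of column j of R_N are
    O(j^(-3/2)).  Drop the first k columns, with k about d N / 2: this changes
    the number of large singular values by at most k, while the remaining
    columns have squared Frobenius norm O(N^2 / k^3).  After scaling by N^g the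
    latter is O(N^(2g-1)) = o(N) because g < 1, so all but d N of the singular
    values are below any given level once N is large, for every d > 0
    (count_large_singular_values, zero_distributed_of_count).

    The bound for w P_n uses only the differential equation.  Orthogonality
    forces L P_n = - n (n+s+1) P_n, where L y = (w (1-x^2) y')' / w, because L
    is symmetric for the weight and does not raise degrees
    (orthogonal_jacobi_op).  The function v = w P_n then solves
    (1-x^2) v'' + (a - b + (s-2) x) v' + (n+1)(n+s) v = 0, and Sonin's function
    f = v^2 + (1-x^2) v'^2 / ((n+1)(n+s)) has

      f' = 2 v'^2 ((b-1/2)(1-x) - (a-1/2)(1+x)) / ((n+1)(n+s)).

    As a and b are at least 1/2, this makes f / (1+x)^(2b-1) nonincreasing and
    f / (1-x)^(2a-1) nondecreasing, so v^2 <= f is bounded on [-1, 1] by a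
    constant times f(0) (sonin_nonincreasing, jacobi_weight_bound).

    It remains to see that f(0) = O(1/n), for which the constants in the
    normalization matter.  A polynomial solution of L y = l y is determined by
    its value at 1 (jacobi_eigen_eq0), and a first-order operator maps the
    solutions for n to those for n - 1 or n + 1 (jacobi_op_ladder).  Comparing
    values at 1, known from Gamma (s + 1) = s Gamma s (GammaS), gives the exact
    relations between P_n, P_n' and P_(n-1), P_(n+1).  At x = 0 they combine to
    P_(n+2)(0) = e_n P_(n+1)(0) - r_n P_n(0), with e_n = O(n^-2) and
    r_n = 1 - 1/n + O(n^-2), whence the energy
    (n+1/2) P_n(0)^2 + (n+3/2) P_(n+1)(0)^2 grows by a factor 1 + O(n^-2) at each
    step and stays bounded (jacobi_energy_at0). *)

Set Implicit Arguments.
Unset Strict Implicit.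
Unset Printing Implicit Defensive.

Import Order.TTheory GRing.Theory Num.Theory.
Import numFieldNormedType.Exports.

Local Open Scope ring_scope.

(** * The Jacobi differential operator on polynomials *)

(** This is (w y')' / w(a,b) with w = (1-x)^(a+1) (1+x)^(b+1), the second-order
    operator that the Jacobi polynomials diagonalize. *)
Definition jacobi_op (R : realFieldType) (a b : R) (y : {poly R}) : {poly R} :=
  (1 - 'X^2) * y^`()^`() + ((b - a)%:P - (a + b + 2)%:P * 'X) * y^`().

Lemma jacobi_opB (R : realFieldType) (a b : R) (y z : {poly R}) :
  jacobi_op a b (y - z) = jacobi_op a b y - jacobi_op a b z.
Proof. by rewrite /jacobi_op !derivB; ring. Qed.

Lemma jacobi_opCM (R : realFieldType) (a b c : R) (y : {poly R}) :
  jacobi_op a b (c%:P * y) = c%:P * jacobi_op a b y.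
Proof. by rewrite /jacobi_op !derivM !derivC !mul0r !add0r !derivM derivC mul0r add0r; ring. Qed.

Lemma jacobi_op_reflect (R : realFieldType) (a b : R) (y : {poly R}) :
  jacobi_op b a (y \Po (- 'X)) = jacobi_op a b y \Po (- 'X).
Proof.
have d (z : {poly R}) : (z \Po - 'X)^`() = - (z^`() \Po - 'X).
  by rewrite deriv_comp derivN derivX mulrN1.
rewrite /jacobi_op !(comp_polyB, comp_polyD, comp_polyM, comp_polyC, expr2).
by rewrite !comp_polyX !(d, derivN); ring.
Qed.

Lemma coef_jacobi_op (R : realFieldType) (a b : R) (y : {poly R}) k :
  (jacobi_op a b y)`_k =
  k.+2%:R * k.+1%:R * y`_k.+2 + (b - a) * k.+1%:R * y`_k.+1
  - k%:R * (k%:R + a + b + 1) * y`_k.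
Proof.
have -> : jacobi_op a b y = y^`()^`() - 'X * ('X * y^`()^`()) +
    (b - a)%:P * y^`() - (a + b + 2)%:P * ('X * y^`()).
  by rewrite /jacobi_op; ring.
rewrite coefB coefD coefB !coefCM !coefXM !coef_deriv.
case: k => [|[|k]] /=; rewrite ?coef_deriv /=; ring.
Qed.

Lemma size_jacobi_op (R : realFieldType) (a b : R) (y : {poly R}) n :
  (size y <= n)%N -> (size (jacobi_op a b y) <= n)%N.
Proof.
move=> yn; apply/leq_sizeP => k nk; rewrite coef_jacobi_op.
by rewrite !(leq_sizeP _ _ yn) ?mulr0 ?addr0 ?subr0 // ?(leq_trans nk) // ltnW.
Qed.

(** In powers of t = x - 1 the equation is a two-term recurrence
    2 (k+1) (k+1+a) p_(k+1) = - (l + k (k+a+b+1)) p_k, whose leading factor never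
    vanishes: the constant term determines the solution. *)
Lemma jacobi_eigen_eq0 (R : realFieldType) (a b l : R) (y : {poly R}) :
  -1 < a -> jacobi_op a b y = l%:P * y -> y.[1] = 0 -> y = 0.
Proof.
move=> ha hy hy1.
set p := y \Po ('X + 1%:P).
have yp : y = p \Po ('X - 1%:P) by rewrite /p comp_polyXaddC_K.
suff p0 : p = 0 by rewrite yp p0 comp_poly0.
(* the equation in the variable x - 1 *)
have E : - ('X * ('X * p^`()^`()) + 2%:P * ('X * p^`()^`()))
   - ((2 * a + 2)%:P * p^`() + (a + b + 2)%:P * ('X * p^`())) = l%:P * p.
  have := congr1 (fun q => q \Po ('X + 1%:P)) hy.
  rewrite /jacobi_op !(comp_polyB, comp_polyD, comp_polyM, comp_polyC, expr2).
  rewrite !comp_polyX.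
  have dp (z : {poly R}) : (z \Po ('X + 1%:P))^`() = z^`() \Po ('X + 1%:P).
    by rewrite deriv_comp derivD derivX derivC addr0 mulr1.
  rewrite -!dp -/p => <-.
  ring.
have rec k : (2 * (k%:R + 1) * (k%:R + 1 + a)) * p`_k.+1 =
    - (l + k%:R * (k%:R + a + b + 1)) * p`_k.
  have := congr1 (fun q : {poly R} => q`_k) E.
  rewrite /= coefB coefN; rewrite !coefD !coefCM; rewrite !coefXM; rewrite !coef_deriv.
  case: k => [|[|k]] /=; rewrite ?subSS ?subn0 ?coef_deriv /=;
    lra.
apply/polyP => k; rewrite coef0; elim: k => [|k IH].
  by rewrite -[RHS]hy1 [in RHS]yp horner_comp !hornerE subrr horner_coef0.
have := rec k; rewrite IH mulr0 => /eqP; rewrite mulf_eq0 => /orP[|/eqP //].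
have k0 : (0 : R) <= k%:R by rewrite ler0n.
by rewrite !mulf_eq0 -!orbA => /or3P[] /eqP; lra.
Qed.

(** The eigenvalue - v (v+a+b+1) is invariant under v |-> - v - a - b - 1, so this
    one operator lowers the degree for v = n and raises it for
    v = - (n+a+b+1). *)
Lemma jacobi_op_ladder (R : realFieldType) (a b v : R) (y : {poly R}) :
  jacobi_op a b y = (- v * (v + a + b + 1))%:P * y ->
  let z := (2 * v + a + b)%:P * (1 - 'X^2) * y^`()
           - v%:P * ((a - b)%:P - (2 * v + a + b)%:P * 'X) * y in
  jacobi_op a b z = (- (v - 1) * (v + a + b))%:P * z.
Proof.
move=> hy /=.
have hy' := congr1 (@deriv R) hy; move: hy hy'.
rewrite /jacobi_op !(derivD, derivB, derivM, derivN, derivC, derivX, derivXn) /=.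
rewrite expr1 -[1 *+ 2]/(2%:R).
set y0 := y; set y1 := y0^`(); set y2 := y1^`(); set y3 := y2^`().
move=> /eqP; rewrite -subr_eq0 => /eqP hy /eqP; rewrite -subr_eq0 => /eqP hy'.
apply/eqP; rewrite -subr_eq0; apply/eqP.
set m := 2 * v + a + b.
(* a combination of the equation and of its derivative: the first coefficient
   cancels y''', the second one then cancels y'' *)
match goal with h0 : ?e0 = 0, h1 : ?e1 = 0 |- ?l = 0 =>
  transitivity (m%:P * (1 - 'X^2) * e1
    + (- v%:P * ((a - b)%:P - m%:P * 'X) - 2%:P * m%:P * 'X) * e0)
  end; last by rewrite hy hy' !mulr0 addr0.
rewrite /m; ring.
Qed.

(** * Sonin's monotone quantity and the bound on the weighted solution *)

(** Up to the factor w^2 / (1-x^2), this is Sonin's function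
    f = (w y)^2 + (1-x^2) (w y)'^2 / L; unlike f it is a polynomial. *)
Definition sonin_poly (R : realFieldType) (a b L : R) (y : {poly R}) : {poly R} :=
  (1 - 'X^2) * y ^+ 2 + (L^-1)%:P *
    (((b - a)%:P - (a + b)%:P * 'X) * y + (1 - 'X^2) * y^`()) ^+ 2.

(** The expression u = (b - a - (a+b) x) y + (1-x^2) y', which is
    (1-x^2) (w y)' / w, satisfies u' = - L y by the differential equation; the
    terms in y y' and u y then cancel. *)
Lemma deriv_sonin_poly (R : realFieldType) (a b L : R) (y : {poly R}) :
  L != 0 -> jacobi_op a b y = (- (L - a - b))%:P * y ->
  (sonin_poly a b L y)^`() =
  (- 2)%:P * ((b - a)%:P - (a + b - 1)%:P * 'X) * y ^+ 2.
Proof.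
move=> L0; rewrite /jacobi_op /sonin_poly.
set u := _ * y + _ => hy.
have du : u^`() = (- L)%:P * y.
  rewrite /u !(derivD, derivB, derivM, derivN, derivC, derivX, derivXn) /=.
  rewrite expr1.
  transitivity ((1 - 'X^2) * y^`()^`() +
     ((b - a)%:P - (a + b + 2)%:P * 'X) * y^`() - (a + b)%:P * y); first ring.
  by rewrite hy; ring.
rewrite derivD [(L^-1%:P * _)^`()]derivM derivC mul0r add0r.
rewrite [(u ^+ 2)^`()]deriv_exp du expr1.
have -> : L^-1%:P * (((- L)%:P * y * u) *+ 2) = - ((u * y) *+ 2).
  have key : L^-1%:P * (- L)%:P = -1 :> {poly R}.
    by rewrite -polyCM mulrN mulVf // polyCN polyC1.
  transitivity ((L^-1%:P * (- L)%:P) * ((y * u) *+ 2)); first ring.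
  by rewrite key; ring.
rewrite /u !(derivD, derivB, derivM, derivN, derivC, derivX, derivXn) /=.
rewrite expr1; ring.
Qed.

(** With A = sonin_poly, the derivative of (1-x)^(2a-1) A is
    - (1-x)^(2a-2) ((2a-1) u^2 / L + (2b-1) (1-x)^2 y^2), where both coefficients
    are nonnegative exactly when a and b are at least 1/2. *)
Lemma sonin_nonincreasing (R : realType) (a b L : R) (y : {poly R}) (x : R) :
  1 / 2 <= a -> 1 / 2 <= b -> 0 < L ->
  jacobi_op a b y = (- (L - a - b))%:P * y -> 0 <= x < 1 ->
  (1 - x) `^ (2 * a - 1) * (sonin_poly a b L y).[x] <= (sonin_poly a b L y).[0].
Proof.
move=> ha hb L0 hy /andP[x0 x1].
set A := sonin_poly a b L y; set c := 2 * a - 1.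
pose G (u : R) : R := (1 - u) `^ c * A.[u].
have dG (u : R) : u < 1 -> is_derive u (1 : R) G
   ((1 - u) `^ c * A^`().[u] + A.[u] * (c * (1 - u) `^ (c - 1) * -1)).
  move=> u1.
  have h1 : is_derive (1 - u) (1 : R) (fun z : R => z `^ c) (c * (1 - u) `^ (c - 1)).
    by apply: is_derive1_powR; rewrite subr_gt0.
  have h2 : is_derive u (1 : R) (fun z : R => 1 - z) (-1).
    apply: trigger_derive.
    by rewrite add0r mul1r.
  have h3 := @is_derive1_comp _ (fun z : R => z `^ c) (fun z : R => 1 - z) u _ _ h1 h2.
  exact: (is_deriveM h3 (is_derive_poly A u)).
have -> : A.[0] = G 0 by rewrite /G subr0 powR1 mul1r.
rewrite -/(G x).
have lt1 u : u \in `]0, x[%R -> u < 1.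
  by rewrite in_itv /= => /andP[_ /lt_trans]; exact.
apply: (@ler0_derive1_nincr _ G 0 x) => //.
- by move=> u /lt1 /dG [].
- move=> u ux; have u1 := lt1 _ ux; have [_ dGu] := dG _ u1.
  move: ux; rewrite in_itv /= => /andP[u0 _].
  rewrite derive1E dGu deriv_sonin_poly ?gt_eqF //.
  have -> : (1 - u) `^ c = (1 - u) * (1 - u) `^ (c - 1).
    have u10 : 0 < 1 - u by rewrite subr_gt0.
    rewrite -{1}(subrKC 1 c) powRD ?powRr1 ?(ltW u10) //.
    by rewrite (gt_eqF u10) implybT.
  set p := (1 - u) `^ (c - 1); have p0 : 0 <= p := powR_ge0 _ _.
  rewrite /A /sonin_poly !hornerE /=.
  set v := y.[u]; set w := (_ + _ * y^`().[u]).
  rewrite [leLHS](_ : _ =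
     - (p * ((2 * a - 1) * (L^-1 * w ^+ 2) +
             (2 * b - 1) * ((1 - u) ^+ 2 * v ^+ 2)))); last by rewrite /c; ring.
  have L'0 : 0 <= L^-1 * w ^+ 2 by rewrite mulr_ge0 ?sqr_ge0 // invr_ge0 ltW.
  have v0 : 0 <= (1 - u) ^+ 2 * v ^+ 2 by rewrite -exprMn sqr_ge0.
  rewrite oppr_le0 mulr_ge0 //.
  by apply: addr_ge0; apply: mulr_ge0 => //; lra.
- apply: derivable_within_continuous => u; rewrite in_itv /= => /andP[_ ux].
  by have [] := dG u (le_lt_trans ux x1).
Qed.

Lemma sonin_poly_ge (R : realFieldType) (a b L : R) (y : {poly R}) (x : R) :
  0 < L -> (1 - x ^+ 2) * y.[x] ^+ 2 <= (sonin_poly a b L y).[x].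
Proof.
move=> L0; rewrite /sonin_poly; set u := _ * y + _.
have e : (1 - 'X^2 : {poly R}).[x] = 1 - x ^+ 2 by rewrite !hornerE.
rewrite hornerD hornerM horner_exp hornerCM horner_exp e lerDl.
by apply: mulr_ge0; rewrite ?sqr_ge0 ?invr_ge0 ?ltW.
Qed.

Lemma sonin_poly0 (R : realFieldType) (a b L : R) (y : {poly R}) :
  (sonin_poly a b L y).[0] =
  y.[0] ^+ 2 + (y^`().[0] - (a - b) * y.[0]) ^+ 2 / L.
Proof. by rewrite /sonin_poly !hornerE expr0n /=; ring. Qed.

(** (w y)^2 = (1+x)^(2b-1) (1-x)^(2a-1) (1-x^2) y^2, where the last two factors
    together are controlled by the monotone quantity and the first one by its
    value at 1. *)
Lemma jacobi_weight_bound_half (R : realType) (a b L : R) (y : {poly R}) (x : R) :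
  1 / 2 <= a -> 1 / 2 <= b -> 0 < L ->
  jacobi_op a b y = (- (L - a - b))%:P * y -> 0 <= x <= 1 ->
  (y.[x] * jacobi_weight a b x) ^+ 2 <=
    2 `^ (2 * b - 1) * (sonin_poly a b L y).[0].
Proof.
move=> ha hb L0 hy /andP[x0]; rewrite le_eqVlt => /predU1P[->|x1].
  rewrite /jacobi_weight subrr powR0 ?gt_eqF; try lra.
  rewrite mul0r mulr0 expr0n /= mulr_ge0 ?powR_ge0 //.
  apply: le_trans (sonin_poly_ge a b y 0 L0).
  by rewrite expr0n subr0 mul1r sqr_ge0.
have xx : 0 <= x < 1 by rewrite x0.
have u0 : 0 < 1 - x by rewrite subr_gt0.
have w0 : 0 < 1 + x by lra.
have S := sonin_nonincreasing ha hb L0 hy xx.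
have A0 := sonin_poly_ge a b y x L0.
have y0 : 0 <= (1 - x ^+ 2) * y.[x] ^+ 2.
  apply: mulr_ge0 (sqr_ge0 _).
  by rewrite (_ : 1 - _ = (1 - x) * (1 + x)); [rewrite mulr_ge0 ?ltW|ring].
have p20 := powR_ge0 2 (2 * b - 1).
apply: le_trans (ler_wpM2l p20 S).
apply: (@le_trans _ _ ((1 + x) `^ (2 * b - 1) *
   ((1 - x) `^ (2 * a - 1) * ((1 - x ^+ 2) * y.[x] ^+ 2)))).
  have e1 (c z : R) : 0 < z -> (z `^ c) ^+ 2 = z `^ (2 * c - 1) * z.
    move=> z0; rewrite -powR_mulrn ?powR_ge0 // -powRrM.
    rewrite -{3}(powRr1 (ltW z0)) -powRD; first by congr (_ `^ _); lra.
    by rewrite (gt_eqF z0) implybT.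
  rewrite /jacobi_weight 2!exprMn !e1 //.
  by rewrite le_eqVlt; apply/orP; left; apply/eqP; ring.
apply: ler_pM; rewrite ?powR_ge0 //.
- by apply: mulr_ge0; rewrite ?powR_ge0.
- by rewrite ge0_ler_powR ?nnegrE //; lra.
- by rewrite ler_wpM2l ?powR_ge0.
Qed.

Lemma jacobi_weight_reflect (R : realType) (a b x : R) :
  jacobi_weight b a (- x) = jacobi_weight a b x.
Proof. by rewrite /jacobi_weight opprK mulrC. Qed.

(** The left half follows from the right one by x |-> - x, which exchanges a
    and b. *)
Lemma jacobi_weight_bound (R : realType) (a b L : R) (y : {poly R}) (x : R) :
  1 / 2 <= a -> 1 / 2 <= b -> 0 < L ->
  jacobi_op a b y = (- (L - a - b))%:P * y -> -1 <= x <= 1 ->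
  (y.[x] * jacobi_weight a b x) ^+ 2 <=
    (2 `^ (2 * a - 1) + 2 `^ (2 * b - 1)) *
    (y.[0] ^+ 2 + (y^`().[0] - (a - b) * y.[0]) ^+ 2 / L).
Proof.
move=> ha hb L0 hy /andP[x1 x2].
have A0 : 0 <= y.[0] ^+ 2 + (y^`().[0] - (a - b) * y.[0]) ^+ 2 / L.
  by rewrite addr_ge0 ?divr_ge0 ?sqr_ge0 ?ltW.
rewrite mulrDl; have [x0|x0] := leP 0 x.
  apply: le_trans (jacobi_weight_bound_half ha hb L0 hy (_ : 0 <= x <= 1)) _.
    by rewrite x0.
  by rewrite sonin_poly0 lerDr mulr_ge0 ?powR_ge0.
have hy' : jacobi_op b a (y \Po - 'X) = (- (L - b - a))%:P * (y \Po - 'X).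
  by rewrite jacobi_op_reflect hy comp_polyM comp_polyC addrAC.
have := jacobi_weight_bound_half hb ha L0 hy' (_ : 0 <= - x <= 1).
rewrite jacobi_weight_reflect horner_comp hornerN hornerX opprK.
move=> H; apply: le_trans (H _) _; first by lra.
rewrite sonin_poly0 deriv_comp !(derivN, derivX, hornerM, hornerN, horner_comp).
rewrite hornerC !hornerX oppr0.
have -> : (y^`().[0] * -1 - (b - a) * y.[0]) ^+ 2 =
          (y^`().[0] - (a - b) * y.[0]) ^+ 2 by ring.
by rewrite lerDl mulr_ge0 ?powR_ge0.
Qed.

(** * Growth of a perturbed three-term recurrence *)

(** The product of the factors converges, since 1 / t^2 is at most the telescoping
    difference 1 / (t - 1/2) - 1 / (t + 1/2). *)
Lemma le_perturbed_growth (R : realType) (D : R) (F : nat -> R) :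
  0 <= D -> (forall n, 0 <= F n) ->
  (forall n, F n.+1 <= (1 + D / n.+1%:R ^+ 2) * F n) ->
  forall n, F n <= expR (2 * D) * F 0%N.
Proof.
move=> D0 F0 FS n.
have n_ge0 (k : nat) : (0 : R) <= k%:R by rewrite ler0n.
suff H : F n <= expR (D * (2 - (n%:R + 1/2)^-1)) * F 0%N.
  apply: le_trans H _; rewrite ler_wpM2r ?F0 // ler_expR mulrC ler_wpM2r //.
  by rewrite lerBlDr lerDl invr_ge0; have := n_ge0 n; lra.
elim: n => [|n IH].
  by rewrite add0r div1r invrK subrr mulr0 expR0 mul1r.
apply: le_trans (FS n) _.
have q0 : 0 <= D / n.+1%:R ^+ 2 by rewrite divr_ge0 // exprn_ge0.
apply: le_trans (ler_wpM2l _ IH) _; first by rewrite addr_ge0.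
rewrite mulrA ler_wpM2r ?F0 //.
apply: le_trans (ler_wpM2r (expR_ge0 _) (expR_ge1Dx _)) _.
rewrite -expRD ler_expR -natr1.
set t := n%:R + 1; have t1 : 1 <= t by have := n_ge0 n; rewrite /t; lra.
have -> : n%:R + 1/2 = t - 1/2 by rewrite /t; lra.
rewrite -mulrDr ler_wpM2l //.
have -> : t ^- 2 + (2 - (t - 1/2)^-1) =
          2 - ((t - 1/2)^-1 - t ^- 2) by lra.
rewrite lerD2l lerN2 -subr_ge0.
have -> : (t - 1 / 2)^-1 - t ^- 2 - (t + 1 / 2)^-1 =
   (1/4) / ((t - 1/2) * (t + 1/2) * t ^+ 2).
  by field; apply/and3P; split; lra.
by rewrite divr_ge0 ?mulr_ge0 ?exprn_ge0 //; lra.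
Qed.

(** For the recurrence y_2 = e y_1 - r y_0 with e of order t^-2 and
    r <= t / (t+1) + O(t^-2), the weights t + k - 1/2 make the energy invariant up
    to the factor 1 + O(t^-2): indeed (t + 3/2) t^2 / (t+1)^2 <= (t - 1/2) (1 + 1 / t^2),
    and the cross term e r y_0 y_1 costs O(t^-2) by Young's inequality. *)
Lemma three_term_energy_step (R : realFieldType) (C c t e r y0 y1 : R) :
  1 <= t -> 0 <= C -> `|e| <= c / t ^+ 2 -> 0 <= r ->
  r * (t + 1) <= t + C / t ->
  (t + 1/2) * y1 ^+ 2 + (t + 3/2) * (e * y1 - r * y0) ^+ 2 <=
  (1 + (3 + 4 * (2 * C + C ^+ 2) + 4 * c ^+ 2) / t ^+ 2) *
    ((t - 1/2) * y0 ^+ 2 + (t + 1/2) * y1 ^+ 2).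
Proof.
move=> t1 C0 he r0 hr.
set h := t ^- 2.
have t0 : 0 < t by lra.
have h0 : 0 < h by rewrite invr_gt0 exprn_gt0.
have h1 : h <= 1 by rewrite invf_le1 ?exprn_gt0 // exprn_ege1.
have th : t ^+ 2 * h = 1 by rewrite mulfV // expf_neq0 ?gt_eqF.
have he2 : e ^+ 2 <= c ^+ 2 * h ^+ 2.
  rewrite -exprMn -real_normK ?num_real // ler_pXn2r ?nnegrE //.
  exact: le_trans (normr_ge0 _) he.
have young : (e * y1 - r * y0) ^+ 2 <=
    (1 + h) * (r ^+ 2 * y0 ^+ 2) + (1 + t ^+ 2) * (e ^+ 2 * y1 ^+ 2).
  rewrite -subr_ge0.
  have -> : (1 + h) * (r ^+ 2 * y0 ^+ 2) + (1 + t ^+ 2) * (e ^+ 2 * y1 ^+ 2) -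
    (e * y1 - r * y0) ^+ 2 = (t * e * y1 + r * y0 / t) ^+ 2.
    by rewrite /h; field; lra.
  exact: sqr_ge0.
have hr2 : (t + 3/2) * r ^+ 2 <= (t - 1/2) * ((1 + h) * (1 + C * h) ^+ 2).
  have hr' : r * (t + 1) <= t * (1 + C * h).
    apply: le_trans hr _; rewrite le_eqVlt; apply/orP; left; apply/eqP.
    by rewrite /h; field; lra.
  have {}hr' : r ^+ 2 * (t + 1) ^+ 2 <= t ^+ 2 * (1 + C * h) ^+ 2.
    rewrite -!exprMn ler_pXn2r ?nnegrE ?mulr_ge0 //; try lra.
    by rewrite addr_ge0 // mulr_ge0 // ltW.
  have t12 : 0 < (t + 1) ^+ 2 by rewrite exprn_gt0; lra.
  rewrite -(ler_pM2r t12) -mulrA.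
  apply: le_trans (ler_wpM2l _ hr') _; first lra.
  rewrite [leLHS]mulrA [leRHS](_ : _ =
     ((t - 1/2) * (t + 1) ^+ 2 * (1 + h)) * (1 + C * h) ^+ 2); last by ring.
  rewrite ler_wpM2r ?sqr_ge0 //.
  have -> : (t - 1 / 2) * (t + 1) ^+ 2 * (1 + h) =
     t ^+ 3 + 3/2 * t ^+ 2 - 1/2 + t * (t ^+ 2 * h) + 3/2 * (t ^+ 2 * h) - 1/2 * h.
    by lra.
  rewrite th; have -> : (t + 3/2) * t ^+ 2 = t ^+ 3 + 3/2 * t ^+ 2 by ring.
  lra.
apply: (@le_trans _ _ ((t + 1 / 2) * y1 ^+ 2 * (1 + 4 * c ^+ 2 * h) +
   (t - 1/2) * y0 ^+ 2 * (1 + (3 + 4 * (2 * C + C ^+ 2)) * h))).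
  apply: (@le_trans _ _ ((t + 1 / 2) * y1 ^+ 2 +
     ((1 + h) * ((t + 3/2) * r ^+ 2 * y0 ^+ 2) +
        (1 + t ^+ 2) * ((t + 3/2) * e ^+ 2 * y1 ^+ 2)))).
    rewrite lerD2l.
    apply: le_trans (ler_wpM2l _ young) _; first lra.
    by rewrite le_eqVlt; apply/orP; left; apply/eqP; ring.
  have S1 : (1 + h) * ((t + 3/2) * r ^+ 2 * y0 ^+ 2) <=
     (t - 1 / 2) * y0 ^+ 2 * (1 + (3 + 4 * (2 * C + C ^+ 2)) * h).
    apply: (@le_trans _ _ ((1 + h) * ((t - 1/2) * ((1 + h) * (1 + C * h) ^+ 2) * y0 ^+ 2))).
      rewrite ler_wpM2l //; first lra.
      by rewrite ler_wpM2r ?sqr_ge0.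
    have -> : (1 + h) * ((t - 1 / 2) * ((1 + h) * (1 + C * h) ^+ 2) * y0 ^+ 2) =
      (t - 1 / 2) * y0 ^+ 2 * ((1 + h) ^+ 2 * (1 + C * h) ^+ 2) by ring.
    have p0 : 0 <= (t - 1 / 2) * y0 ^+ 2.
      by apply: mulr_ge0; [lra | exact: sqr_ge0].
    rewrite ler_wpM2l //.
    have hh : h ^+ 2 <= h by rewrite expr2 ger_pMl.
    have B1 : (1 + h) ^+ 2 <= 1 + 3 * h by lra.
    have B2 : (1 + C * h) ^+ 2 <= 1 + (2 * C + C ^+ 2) * h.
      have : C ^+ 2 * h ^+ 2 <= C ^+ 2 * h by rewrite ler_wpM2l ?sqr_ge0.
      rewrite sqrrD exprMn; lra.
    apply: le_trans (ler_pM (sqr_ge0 _) (sqr_ge0 _) B1 B2) _.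
    set B := 2 * C + C ^+ 2; have B0 : 0 <= B by rewrite addr_ge0 ?sqr_ge0; lra.
    have : B * h ^+ 2 <= B * h by rewrite ler_wpM2l.
    lra.
  have S2 : (1 + t ^+ 2) * ((t + 3/2) * e ^+ 2 * y1 ^+ 2) <=
     (t + 1 / 2) * y1 ^+ 2 * (4 * c ^+ 2 * h).
    have -> : (1 + t ^+ 2) * ((t + 3/2) * e ^+ 2 * y1 ^+ 2) =
       y1 ^+ 2 * ((t + 3/2) * ((1 + t ^+ 2) * e ^+ 2)) by ring.
    have -> : (t + 1 / 2) * y1 ^+ 2 * (4 * c ^+ 2 * h) =
       y1 ^+ 2 * ((2 * (t + 1 / 2)) * (2 * (c ^+ 2 * h))) by ring.
    rewrite ler_wpM2l ?sqr_ge0 //.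
    have e20 : 0 <= (1 + t ^+ 2) * e ^+ 2.
      by apply: mulr_ge0; rewrite ?addr_ge0 ?sqr_ge0.
    apply: ler_pM => //; try lra.
    apply: (@le_trans _ _ ((2 * t ^+ 2) * (c ^+ 2 * h ^+ 2))).
      rewrite ler_pM ?sqr_ge0 ?addr_ge0 ?sqr_ge0 //.
      have : 1 <= t ^+ 2 by rewrite exprn_ege1.
      lra.
    have -> : 2 * t ^+ 2 * (c ^+ 2 * h ^+ 2) = 2 * (c ^+ 2 * h) * (t ^+ 2 * h) by ring.
    by rewrite th mulr1.
  lra.
have M1 : 0 <= (t + 1/2) * y1 ^+ 2 * h.
  by apply: mulr_ge0 (ltW h0); apply: mulr_ge0; [lra | exact: sqr_ge0].
have M0 : 0 <= (t - 1/2) * y0 ^+ 2 * h.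
  by apply: mulr_ge0 (ltW h0); apply: mulr_ge0; [lra | exact: sqr_ge0].
rewrite -subr_ge0 -/h.
set B := 4 * (2 * C + C ^+ 2); have B0 : 0 <= 3 + B.
  by rewrite addr_ge0 // mulr_ge0 // addr_ge0 ?sqr_ge0; lra.
set c4 := 4 * c ^+ 2; have c40 : 0 <= c4 by rewrite mulr_ge0 ?sqr_ge0.
have -> : (1 + (3 + B + c4) * h) *
   ((t - 1 / 2) * y0 ^+ 2 + (t + 1 / 2) * y1 ^+ 2) -
   ((t + 1 / 2) * y1 ^+ 2 * (1 + c4 * h) + (t - 1 / 2) * y0 ^+ 2 * (1 + (3 + B) * h)) =
   c4 * ((t - 1/2) * y0 ^+ 2 * h) + (3 + B) * ((t + 1/2) * y1 ^+ 2 * h) by ring.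
by apply: addr_ge0; apply: mulr_ge0.
Qed.

(** * Ladder relations and the size of Jacobi polynomials at 0 *)

Section JacobiFamily.
Variables (R : realType) (a b : R) (P : nat -> {poly R}).
Hypotheses (ha : 1 / 2 <= a) (hb : 1 / 2 <= b).
Hypothesis eigenP : forall n,
  jacobi_op a b (P n) = (- (n%:R * (n%:R + a + b + 1)))%:P * P n.
Hypothesis P1 : forall n,
  n.+1%:R * (P n.+1).[1] = (n.+1%:R + a) * (P n).[1].

Let a_gtN1 : -1 < a.
Proof. by have := ha; lra. Qed.

(** Both sides are eigenfunctions for the same eigenvalue, so it is enough to
    compare their values at 1. *)
Lemma jacobi_lowering n :
  (2 * n.+1%:R + a + b)%:P * (1 - 'X^2) * (P n.+1)^`() -
  (n.+1%:R)%:P * ((a - b)%:P - (2 * n.+1%:R + a + b)%:P * 'X) * P n.+1 =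
  (2 * (n.+1%:R + a) * (n.+1%:R + b))%:P * P n.
Proof.
have e : jacobi_op a b (P n.+1) =
    (- n.+1%:R * (n.+1%:R + a + b + 1))%:P * P n.+1 by rewrite eigenP mulNr.
have /= hz := jacobi_op_ladder e.
apply/eqP; rewrite -subr_eq0; apply/eqP.
apply: (@jacobi_eigen_eq0 _ a b (- (n%:R * (n%:R + a + b + 1)))).
- exact: a_gtN1.
- rewrite jacobi_opB jacobi_opCM hz eigenP -natr1; ring.
rewrite !hornerE; have := P1 n.
move: (P n.+1).[1] (P n).[1] => p1 p0 /(congr1 ( *%R (2 * (n.+1%:R + b)))) /=; lra.
Qed.

Lemma jacobi_raising n :
  (- (2 * n%:R + a + b + 2))%:P * (1 - 'X^2) * (P n)^`() +
  (n%:R + a + b + 1)%:P * ((a - b)%:P + (2 * n%:R + a + b + 2)%:P * 'X) * P n =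
  (2 * (n%:R + a + b + 1) * (n.+1%:R))%:P * P n.+1.
Proof.
have e : jacobi_op a b (P n) =
    (- (- (n%:R + a + b + 1)) * (- (n%:R + a + b + 1) + a + b + 1))%:P * P n.
  by rewrite eigenP; congr (_%:P * _); ring.
have /= hz := jacobi_op_ladder e.
apply/eqP; rewrite -subr_eq0; apply/eqP.
apply: (@jacobi_eigen_eq0 _ a b (- (n.+1%:R * (n.+1%:R + a + b + 1)))).
- exact: a_gtN1.
- rewrite jacobi_opB jacobi_opCM eigenP -natr1 [RHS]mulrBr.
  congr (_ - _); last by ring.
  move: hz; set z := (X in jacobi_op a b X); set z' := (X in _ -> jacobi_op a b X = _).
  have -> : z' = z by rewrite /z /z'; ring.
  by move=> ->; ring.
rewrite !hornerE; have := P1 n; rewrite -natr1.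
move: (P n.+1).[1] (P n).[1] => p1 p0 /(congr1 ( *%R (2 * (n%:R + a + b + 1)))) /=; lra.
Qed.

Lemma jacobi_lowering_at0 n :
  (2 * n.+1%:R + a + b) * (P n.+1)^`().[0] - n.+1%:R * (a - b) * (P n.+1).[0] =
  2 * (n.+1%:R + a) * (n.+1%:R + b) * (P n).[0].
Proof.
have := congr1 (horner^~ 0) (jacobi_lowering n).
by rewrite /= !hornerE expr0n /= ?addr0 !subr0 ?mulr1.
Qed.

Lemma jacobi_raising_at0 n :
  - (2 * n%:R + a + b + 2) * (P n)^`().[0] +
    (n%:R + a + b + 1) * (a - b) * (P n).[0] =
  2 * (n%:R + a + b + 1) * n.+1%:R * (P n.+1).[0].
Proof.
have := congr1 (horner^~ 0) (jacobi_raising n).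
by rewrite /= !hornerE expr0n /= ?addr0 !subr0 ?mulr1.
Qed.

(** P_(n+1)'(0) is eliminated between the two ladder relations that contain it.  In
    the coefficient of P_(n+1)(0) the terms of order 1/t cancel. *)
Lemma jacobi_at0_rec n (t := n.+1%:R : R) : exists e r : R,
  [/\ (P n.+2).[0] = e * (P n.+1).[0] - r * (P n).[0],
      `|e| <= `|a - b| * (a + b) / t ^+ 2, 0 <= r &
      r * (t + 1) <= t + (a + b + (a + b + 4) * (a * b)) / 2 / t].
Proof.
have t1 : 1 <= t by rewrite ler1n.
have := jacobi_raising_at0 n.+1; have := jacobi_lowering_at0 n.
rewrite -(natr1 n.+1) -/t.
move: (P n.+2).[0] (P n.+1).[0] (P n).[0] (P n.+1)^`().[0] => y2 y1 y0 d1.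
have := ha; have := hb => hb' ha'; move: t t1 => {}t t1 low up.
have ab0 : 1/4 <= a * b by rewrite (_ : 1/4 = 1/2 * (1/2)) ?ler_pM //; lra.
exists ((a - b) * ((a + b) * (2 * t + a + b + 1) /
          (2 * (2 * t + a + b) * (t + a + b + 1) * (t + 1)))).
exists ((2 * t + a + b + 2) * ((t + a) * (t + b)) /
          ((2 * t + a + b) * (t + a + b + 1) * (t + 1))).
have m0 : 0 < 2 * t + a + b by lra.
have q0 : 0 < t + a + b + 1 by lra.
have tS : 0 < t + 1 by lra.
split.
- have c0 : 2 * (2 * t + a + b) * (t + a + b + 1) * (t + 1) != 0.
    by rewrite !mulf_neq0 ?gt_eqF //; lra.
  apply: (mulfI c0).
  have -> : 2 * (2 * t + a + b) * (t + a + b + 1) * (t + 1) * y2 =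
    (2 * t + a + b) * (2 * (t + a + b + 1) * (t + 1) * y2) by ring.
  rewrite -up.
  transitivity (- (2 * t + a + b + 2) * ((2 * t + a + b) * d1) +
    (2 * t + a + b) * ((t + a + b + 1) * (a - b) * y1)); first ring.
  have -> : (2 * t + a + b) * d1 = 2 * (t + a) * (t + b) * y0 + t * (a - b) * y1.
    by lra.
  by field; rewrite !gt_eqF.
- rewrite normrM -[leRHS]mulrA ler_wpM2l //.
  rewrite ger0_norm; last by rewrite divr_ge0 ?mulr_ge0 //; lra.
  rewrite -[leLHS]mulrA ler_wpM2l //; first lra.
  rewrite ler_pdivrMr ?mulr_gt0 //; try lra.
  rewrite [leRHS]mulrC ler_pdivlMr ?exprn_gt0 //; last lra.
  have : t ^+ 2 <= (t + a + b + 1) * (t + 1).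
    by rewrite expr2 ler_pM //; lra.
  have : 2 * t + a + b + 1 <= 2 * (2 * t + a + b) by lra.
  move=> h1 h2; rewrite -[leRHS]mulrA ler_pM ?sqr_ge0 //; lra.
- by rewrite divr_ge0 ?mulr_ge0 //; lra.
- rewrite mulrAC ler_pdivrMr ?mulr_gt0 //; try lra.
  set C := (_ / 2 in leRHS).
  rewrite [leRHS]mulrA ler_wpM2r ?(ltW tS) //.
  suff : 0 <= (t + C / t) * ((2 * t + a + b) * (t + a + b + 1)) -
      (2 * t + a + b + 2) * ((t + a) * (t + b)) by lra.
  have -> : (t + C / t) * ((2 * t + a + b) * (t + a + b + 1)) -
      (2 * t + a + b + 2) * ((t + a) * (t + b)) =
     (a + b + 2) * (a * b) * (t - 1) + C * (3 * (a + b) + 2 + (a + b) * (a + b + 1) / t).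
    by rewrite /C; field; lra.
  have C0 : 0 <= C by rewrite /C !(addr_ge0, mulr_ge0) //; lra.
  have Q : 0 <= (a + b) * (a + b + 1) / t by rewrite divr_ge0 ?mulr_ge0 //; lra.
  apply: addr_ge0; last by apply: mulr_ge0 => //; lra.
  by apply: mulr_ge0; [apply: mulr_ge0|]; lra.
Qed.

(** The left side is Sonin's function at 0.  Its second term is expressed through
    P_n(0) and P_(n+1)(0) by the raising relation. *)
Lemma jacobi_energy_at0 : exists2 K : R, 0 <= K & forall n,
  (P n).[0] ^+ 2 + ((P n)^`().[0] - (a - b) * (P n).[0]) ^+ 2 /
     (n.+1%:R * (n%:R + a + b)) <= K / n.+1%:R.
Proof.
set C := (a + b + (a + b + 4) * (a * b)) / 2; set c := `|a - b| * (a + b).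
set D := 3 + 4 * (2 * C + C ^+ 2) + 4 * c ^+ 2.
pose F n := (n%:R + 1/2) * (P n).[0] ^+ 2 + (n%:R + 3/2) * (P n.+1).[0] ^+ 2.
have C0 : 0 <= C by rewrite /C !(addr_ge0, mulr_ge0) //; have := ha; have := hb; lra.
have D0 : 0 <= D by have := sqr_ge0 C; have := sqr_ge0 c; rewrite /D; lra.
have n_ge0 (k : nat) : (0 : R) <= k%:R by rewrite ler0n.
have F0 n : 0 <= F n.
  by apply: addr_ge0; apply: mulr_ge0; rewrite ?sqr_ge0 //; have := n_ge0 n; lra.
have FS n : F n.+1 <= (1 + D / n.+1%:R ^+ 2) * F n.
  have [e [r [hy he hr hr']]] := jacobi_at0_rec n.
  have t1 : (1 : R) <= n.+1%:R by rewrite ler1n.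
  have := three_term_energy_step (P n).[0] (P n.+1).[0] t1 C0 he hr hr'.
  have tn : n.+1%:R = n%:R + 1 :> R by rewrite natr1.
  have e1 : n%:R + 1 / 2 = n.+1%:R - 1 / 2 :> R by rewrite tn; lra.
  have e2 : n%:R + 3 / 2 = n.+1%:R + 1 / 2 :> R by rewrite tn; lra.
  by rewrite -/D /F hy e1 e2.
have FK := le_perturbed_growth D0 F0 FS.
set K := expR (2 * D) * F 0%N in FK.
have K0 : 0 <= K by rewrite mulr_ge0 ?expR_ge0.
exists ((9 + 8 * (a - b) ^+ 2) * (2 * K)).
  by apply: mulr_ge0; [have := sqr_ge0 (a - b)|]; lra.
move=> n; rewrite ler_pdivlMr ?ltr0Sn //.
have := jacobi_raising_at0 n; have := FK n; rewrite /F -(natr1 n); have := n_ge0 n.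
move: (P n.+1).[0] (P n).[0] (P n)^`().[0] => y1 y0 d.
move: n%:R => t t0 hF hd.
have := ha; have := hb => hb' ha'; set l := a - b in hd *.
have y00 : 0 <= y0 ^+ 2 := sqr_ge0 _; have y10 : 0 <= y1 ^+ 2 := sqr_ge0 _.
have w : (d - l * y0) ^+ 2 <= (t + 1) ^+ 2 * (2 * l ^+ 2 * y0 ^+ 2 + 8 * y1 ^+ 2).
  set m := 2 * t + a + b + 2 in hd.
  have m2 : 1 <= m by rewrite /m; lra.
  have m20 : 0 < m ^+ 2 by rewrite exprn_gt0 //; lra.
  rewrite -(ler_pM2l m20) -exprMn.
  have -> : m * (d - l * y0) = - ((t + 1) * (l * y0 + 2 * (t + a + b + 1) * y1)).
    by have := hd; rewrite /m; lra.
  rewrite sqrrN exprMn [leRHS]mulrCA ler_wpM2l ?sqr_ge0 //.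
  apply: (@le_trans _ _ (2 * (l * y0) ^+ 2 + 2 * (2 * (t + a + b + 1) * y1) ^+ 2)).
    rewrite -subr_ge0.
    set u := l * y0; set v := 2 * _ * _.
    have -> : 2 * u ^+ 2 + 2 * v ^+ 2 - (u + v) ^+ 2 = (u - v) ^+ 2 by ring.
    exact: sqr_ge0.
  rewrite [leRHS]mulrDr; apply: lerD.
    rewrite exprMn [leLHS]mulrA ler_peMl ?exprn_ege1 //.
    by rewrite -mulrA; apply: mulr_ge0 => //; apply: mulr_ge0 => //; exact: sqr_ge0.
  have -> : 2 * (2 * (t + a + b + 1) * y1) ^+ 2 = (t + a + b + 1) ^+ 2 * (8 * y1 ^+ 2).
    by ring.
  have p1 : 0 <= 8 * y1 ^+ 2 by lra.
  by rewrite ler_wpM2r // ler_pXn2r ?nnegrE //; rewrite /m; lra.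
have q : (d - l * y0) ^+ 2 / ((t + 1) * (t + a + b)) <=
    2 * l ^+ 2 * y0 ^+ 2 + 8 * y1 ^+ 2.
  rewrite ler_pdivrMr ?mulr_gt0 //; try lra.
  apply: le_trans w _; rewrite mulrC ler_wpM2l //.
    apply: addr_ge0; last by lra.
    by apply: mulr_ge0 => //; have := sqr_ge0 l; lra.
  by rewrite expr2 ler_wpM2l //; lra.
have t1 : 0 <= t + 1 by lra.
apply: le_trans (ler_wpM2r t1 (lerD (lexx _) q)) _.
have hy1 : y1 ^+ 2 * (t + 1) <= K.
  have : 0 <= (t + 1 / 2) * y0 ^+ 2 by apply: mulr_ge0; lra.
  lra.
have hy0 : y0 ^+ 2 * (t + 1) <= 2 * K.
  have : 0 <= (t + 3 / 2) * y1 ^+ 2 by apply: mulr_ge0; lra.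
  have : 0 <= t * y0 ^+ 2 by apply: mulr_ge0; lra.
  lra.
have l0 : 0 <= l ^+ 2 := sqr_ge0 _.
have : l ^+ 2 * (y0 ^+ 2 * (t + 1)) <= l ^+ 2 * (2 * K) by rewrite ler_wpM2l.
have : 0 <= l ^+ 2 * K by rewrite mulr_ge0.
lra.
Qed.
End JacobiFamily.

(** * Integration against the Jacobi weight *)

Lemma continuous_normr_powR (R : realType) (c : R) : 0 < c ->
  continuous (fun x : R => `|x| `^ c).
Proof.
move=> c0 x; have [->|x0] := eqVneq x 0.
  apply/cvgrPdist_lt => e e0; rewrite normr0 powR0 ?gt_eqF //.
  apply/nbhs_ballP; exists (e `^ c^-1); first exact: powR_gt0.
  move=> y; rewrite /ball /= !sub0r !normrN => hy.
  rewrite ger0_norm ?powR_ge0 //.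
  have -> : e = (e `^ c^-1) `^ c by rewrite -powRrM mulVf ?gt_eqF // powRr1 ?ltW.
  by rewrite gt0_ltr_powR ?nnegrE ?powR_ge0.
apply: (@continuous_comp _ _ _ (fun x : R => `|x|) (fun y : R => y `^ c)).
  exact: norm_continuous.
apply: differentiable_continuous; apply/derivable1_diffP.
by apply: derivable_powR; rewrite in_itv /= andbT normr_gt0.
Qed.

(** The Jacobi weight itself is not continuous at the points 1 and -1 of the line,
    since x `^ a is 1 for x < 0.  This function agrees with it on [-1, 1] and is
    continuous everywhere when a and b are positive. *)
Definition weight_ext (R : realType) (a b t : R) : R :=
  `|1 - t| `^ a * `|1 + t| `^ b.

Lemma weight_extE (R : realType) (a b t : R) :
  -1 <= t <= 1 -> jacobi_weight a b t = weight_ext a b t.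
Proof.
move=> /andP[t1 t2]; rewrite /jacobi_weight /weight_ext !ger0_norm //; lra.
Qed.

Lemma continuous_weight_ext (R : realType) (a b : R) : 0 < a -> 0 < b ->
  continuous (weight_ext a b).
Proof.
move=> a0 b0 t; apply: cvgM.
  apply: (@continuous_comp _ _ _ (fun t : R => 1 - t) (fun y : R => `|y| `^ a)).
    by apply: cvgB; [exact: cvg_cst|exact: cvg_id].
  exact: continuous_normr_powR.
apply: (@continuous_comp _ _ _ (fun t : R => 1 + t) (fun y : R => `|y| `^ b)).
  by apply: cvgD; [exact: cvg_cst|exact: cvg_id].
exact: continuous_normr_powR.
Qed.

Section WeightedIntegral.
Local Open Scope classical_set_scope.
Variables (R : realType) (a b : R).
Hypotheses (a0 : 0 < a) (b0 : 0 < b).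

Definition wint (p : {poly R}) : R :=
  \int[lebesgue_measure]_(t in `[(-1 : R), 1]) (p.[t] * jacobi_weight a b t).

Let W := weight_ext a b.

Lemma wintE p :
  wint p = \int[lebesgue_measure]_(t in `[(-1 : R), 1]) (p.[t] * W t).
Proof.
by apply: eq_Rintegral => t; rewrite inE /= in_itv /= => /weight_extE ->.
Qed.

Lemma continuous_pW (p : {poly R}) : continuous (fun t : R => p.[t] * W t).
Proof.
move=> t; apply: cvgM; first exact: continuous_horner.
exact: continuous_weight_ext.
Qed.

Lemma integrable_pW (p : {poly R}) :
  lebesgue_measure.-integrable `[(-1 : R), 1] (EFin \o (fun t : R => p.[t] * W t)).
Proof.
apply: continuous_compact_integrable; first exact: segment_compact.
by apply: continuous_subspaceT; exact: continuous_pW.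
Qed.

Lemma wintB p q : wint (p - q) = wint p - wint q.
Proof.
rewrite !wintE -RintegralB //; try exact: integrable_pW.
by apply: eq_Rintegral => t _; rewrite hornerD hornerN mulrBl.
Qed.

Lemma wintC c p : wint (c%:P * p) = c * wint p.
Proof.
rewrite !wintE -RintegralZl //; try exact: integrable_pW.
by apply: eq_Rintegral => t _; rewrite hornerCM -[LHS]mulrA.
Qed.

Lemma wintD p q : wint (p + q) = wint p + wint q.
Proof.
have -> : p + q = p - (-1)%:P * q by rewrite polyCN polyC1 mulN1r opprK.
by rewrite wintB wintC mulN1r opprK.
Qed.

(** A nonzero polynomial has a point x of ]-1, 1[ where it does not vanish; near x
    the integrand is bounded below, so the integral is positive. *)
Lemma wint_sqr_eq0 p : wint (p ^+ 2) = 0 -> p = 0.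
Proof.
move=> p20; apply/eqP/negPn/negP => p0.
have : exists2 x : R, -1 < x < 1 & p.[x] != 0.
  (* one more candidate point than p can have roots *)
  pose s := [seq (2 * i.+1%:R)^-1 : R | i <- iota 0 (size p)].
  have : ~~ all (root p) s.
    apply/negP => /(max_poly_roots p0); rewrite size_map size_iota ltnn.
    move=> H; suff /H : uniq s by [].
    rewrite map_inj_uniq ?iota_uniq // => i j /invr_inj /(mulfI _).
    by rewrite pnatr_eq0 => /(_ isT)/eqP; rewrite eqr_nat eqSS => /eqP.
  move=> /allPn[x /mapP[i _ ->]] hx; exists (2 * i.+1%:R)^-1 => //.
  have : (1 : R) <= i.+1%:R by rewrite ler1n.
  move=> i1; have i2 : 0 < 2 * i.+1%:R :> R by lra.
  have v0 : 0 < (2 * i.+1%:R)^-1 :> R by rewrite invr_gt0.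
  have -> : (2 * i.+1%:R)^-1 < 1 :> R by rewrite invf_lt1 //; lra.
  by rewrite andbT (lt_trans _ v0) // ltrN10.
move=> [x /andP[x1 x2] px].
pose f (t : R) : R := (p ^+ 2).[t] * W t.
have f0 t : 0 <= f t by rewrite mulr_ge0 ?horner_exp ?sqr_ge0 // mulr_ge0 ?powR_ge0.
have fx : 0 < f x.
  rewrite /f horner_exp mulr_gt0 ?exprn_even_gt0 //.
  by rewrite mulr_gt0 // powR_gt0 // normr_gt0; lra.
have cf : continuous f := continuous_pW (p := p ^+ 2).
have fx2 : 0 < f x / 2 by rewrite divr_gt0.
have : \forall t \near x, f x / 2 <= f t.
  have /cvgrPdist_lt/(_ _ fx2) := cf x; apply: filterS => t.
  by rewrite ltr_distlC => /andP[]; lra.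
move=> /nbhs_ballP[d /= d0 Hd].
pose e := Num.min (d / 2) (1 - x).
have e0 : 0 < e by rewrite lt_min; apply/andP; split; lra.
have [ed ex] : e <= d / 2 /\ e <= 1 - x by apply/andP; rewrite -le_min.
have if0 : (\int[lebesgue_measure]_(t in `[((-1)%R : R), 1%R]) (f t)%:E = 0)%E.
  rewrite -[LHS]fineK; last by apply: integrable_fin_num => //; exact: integrable_pW.
  by congr (_%:E); rewrite -[RHS]p20 wintE.
have mf := measurable_int _ (integrable_pW (p ^+ 2)).
have sub : `[x, x + e] `<=` `[(-1 : R), 1].
  by move=> t /=; rewrite !in_itv /= => /andP[]; lra.
have : ((f x / 2 * e)%:E <= 0)%E.
  rewrite -if0.
  apply: (@le_trans _ _ (\int[lebesgue_measure]_(t in `[x, (x + e)%R]) (f t)%:E)%E);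
    last first.
    apply: ge0_subset_integral => //.
    by move=> t _; rewrite lee_fin.
  have -> : (f x / 2 * e)%:E =
      (\int[lebesgue_measure]_(t in `[x, (x + e)%R]) (cst (f x / 2)%:E t))%E.
    rewrite integral_cst //= lebesgue_measure_itv /= lte_fin ltrDl e0.
    by rewrite -EFinB addrAC subrr add0r.
  apply: ge0_le_integral => //.
  - by move=> t _; rewrite lee_fin ltW.
  - by apply: measurable_funS mf.
  - move=> t /=; rewrite in_itv /= => /andP[t1 t2]; rewrite lee_fin; apply: Hd.
    rewrite /ball /= distrC ger0_norm; lra.
by rewrite lee_fin leNgt mulr_gt0.
Qed.

(** The integrand is the derivative of (1-x)^(a+1) (1+x)^(b+1) g, which vanishes at
    both ends. *)
Lemma wint_deriv_eq0 (g : {poly R}) :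
  wint ((1 - 'X^2) * g^`() + ((b - a)%:P - (a + b + 2)%:P * 'X) * g) = 0.
Proof.
have a00 := a0; have b00 := b0; rewrite wintE /Rintegral.
pose F (t : R) : R := jacobi_weight (a + 1) (b + 1) t * g.[t].
pose G (t : R) : R := weight_ext (a + 1) (b + 1) t * g.[t].
have FG t : -1 <= t <= 1 -> F t = G t by move=> /weight_extE; rewrite /F /G => ->.
have cG : continuous G.
  move=> t; apply: cvgM; last exact: continuous_horner.
  by apply: continuous_weight_ext; lra.
have dF (t : R) : -1 < t < 1 -> is_derive t (1 : R) F
  (jacobi_weight a b t * ((1 - 'X^2) * g^`() +
     ((b - a)%:P - (a + b + 2)%:P * 'X) * g).[t]).
  move=> /andP[t1 t2].
  have h1 : is_derive (1 - t) (1 : R) (fun z : R => z `^ (a + 1)) ((a + 1) * (1 - t) `^ a).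
    by have := @is_derive1_powR R (a + 1) (1 - t); rewrite addrK; apply; lra.
  have h2 : is_derive t (1 : R) (fun z : R => 1 - z) (-1).
    by apply: trigger_derive; rewrite add0r mul1r.
  have h3 := @is_derive1_comp _ (fun z : R => z `^ (a + 1)) (fun z : R => 1 - z) t _ _ h1 h2.
  have k1 : is_derive (1 + t) (1 : R) (fun z : R => z `^ (b + 1)) ((b + 1) * (1 + t) `^ b).
    by have := @is_derive1_powR R (b + 1) (1 + t); rewrite addrK; apply; lra.
  have k2 : is_derive t (1 : R) (fun z : R => 1 + z) 1.
    by apply: trigger_derive; rewrite add0r ?mul1r ?mulr1.
  have k3 := @is_derive1_comp _ (fun z : R => z `^ (b + 1)) (fun z : R => 1 + z) t _ _ k1 k2.
  apply: (trigger_derive (is_deriveM (is_deriveM h3 k3) (is_derive_poly g t))).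
  have e1 : (1 - t) `^ (a + 1) = (1 - t) `^ a * (1 - t).
    have u0 : 0 < 1 - t by lra.
    by rewrite powRD ?powRr1 ?ltW // (gt_eqF u0) implybT.
  have e2 : (1 + t) `^ (b + 1) = (1 + t) `^ b * (1 + t).
    have u0 : 0 < 1 + t by lra.
    by rewrite powRD ?powRr1 ?ltW // (gt_eqF u0) implybT.
  rewrite [X in X *: g^`().[t]](_ : _ =
    (1 - t) `^ (a + 1) * (1 + t) `^ (b + 1)) //.
  rewrite /jacobi_weight !hornerE /= e1 e2 /GRing.scale /=.
  ring.
rewrite (@continuous_FTC2 _ _ F) //=.
- rewrite !FG ?lexx /= ?andbT; try lra.
  have a1 : a + 1 != 0 by rewrite gt_eqF //; lra.
  have b1 : b + 1 != 0 by rewrite gt_eqF //; lra.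
  by rewrite /G /weight_ext subrr normr0 !powR0 // !(mul0r, mulr0) subrr.
- by apply: continuous_subspaceT; exact: continuous_pW.
- have bnd (t : R) (E : set_system R) : Filter E -> E --> nbhs t ->
      (\forall u \near E, -1 <= u <= 1) -> -1 <= t <= 1 -> F u @[u --> E] --> F t.
    move=> FE Et hE tt; rewrite FG //.
    have : G u @[u --> E] --> G t by apply: cvg_trans (cG t); exact: cvg_app.
    apply: cvg_trans; apply: near_eq_cvg.
    by apply: filterS hE => u /FG ->.
  split.
  + by move=> t; rewrite in_itv /= => tt; have [] := dF t tt.
  + apply: bnd; [exact: cvg_within| |by rewrite lexx /=; lra].
    near=> u; apply/andP; split; near: u; first exact: nbhs_right_ge.
    by apply: nbhs_right_le; lra.
  + apply: bnd; [exact: cvg_within| |by rewrite lexx andbT; lra].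
    near=> u; apply/andP; split; near: u; last exact: nbhs_left_le.
    by apply: nbhs_left_ge; lra.
- move=> t; rewrite in_itv /= => tt; have [_] := dF t tt.
  rewrite derive1E => ->; rewrite mulrC weight_extE //.
  by case/andP: tt => *; apply/andP; split; apply: ltW.
Unshelve. all: by end_near.
Qed.

(** Green's formula: w (L p q - p L q) is the derivative of
    w (1-x^2) (p' q - p q'). *)
Lemma wint_jacobi_op_sym (p q : {poly R}) :
  wint (jacobi_op a b p * q) = wint (p * jacobi_op a b q).
Proof.
apply/eqP; rewrite -subr_eq0 -wintB -(wint_deriv_eq0 (p^`() * q - p * q^`())).
apply/eqP; congr wint.
by rewrite /jacobi_op !(derivB, derivM); ring.
Qed.

End WeightedIntegral.

(** * Orthogonal polynomials are eigenfunctions *)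

Section Orthogonal.
Variables (R : realType) (a b : R) (P : nat -> {poly R}).
Hypotheses (a0 : 0 < a) (b0 : 0 < b).
Hypothesis sizeP : forall n, size (P n) = n.+1.
Hypothesis orthP : forall i j, i <> j -> wint a b (P i * P j) = 0.

Let coef_gt_size n j : (n < j)%N -> (P n)`_j = 0.
Proof. by move=> nj; rewrite nth_default // sizeP. Qed.

(** The P_i with i < k span the polynomials of size at most k. *)
Lemma orthogonal_low_degree n (q : {poly R}) : (size q <= n)%N ->
  wint a b (P n * q) = 0.
Proof.
suff H k : (k <= n)%N -> forall q : {poly R}, (size q <= k)%N ->
    wint a b (P n * q) = 0 by move=> /H; apply.
elim: k => [|k IH] kn {}q sq.
  move: sq; rewrite leqn0 size_poly_eq0 => /eqP ->.
  by rewrite -(mul0r (P n)) -polyC0 mulrCA wintC // mul0r.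
have lk : (P k)`_k != 0.
  by rewrite -[X in _`_X]/(k.+1.-1) -sizeP -lead_coefE lead_coef_eq0 -size_poly_eq0 sizeP.
set c := q`_k / (P k)`_k.
have -> : P n * q = P n * (q - c%:P * P k) + c%:P * (P n * P k) by ring.
rewrite wintD // wintC // orthP; last by move=> nk; rewrite nk ltnn in kn.
rewrite mulr0 addr0 IH ?(ltnW kn) //.
apply/leq_sizeP => j; rewrite leq_eqVlt coefB coefCM => /predU1P[<-|kj].
  by rewrite /c divfK // subrr.
by rewrite (leq_sizeP _ _ sq) // coef_gt_size // mulr0 subrr.
Qed.

(** The remainder L P_n - l P_n has size at most n because its coefficient of
    degree n cancels; by symmetry of L it is orthogonal to itself. *)
Lemma orthogonal_jacobi_op n :
  jacobi_op a b (P n) = (- (n%:R * (n%:R + a + b + 1)))%:P * P n.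
Proof.
apply/eqP; rewrite -subr_eq0; apply/eqP.
pose l : R := - (n%:R * (n%:R + a + b + 1)).
set r : {poly R} := _ - _.
have sr : (size r <= n)%N.
  apply/leq_sizeP => j; rewrite leq_eqVlt coefB coefCM coef_jacobi_op.
  move=> /predU1P[<-|nj]; last first.
    have [nj1 nj2] : (n < j.+1)%N /\ (n < j.+2)%N by rewrite !ltnS !(leqW, ltnW nj).
    by rewrite !coef_gt_size //; ring.
  have nn2 : (n < n.+2)%N by rewrite ltnS leqW.
  rewrite (coef_gt_size (ltnSn n)) (coef_gt_size nn2) /l; ring.
apply: (@wint_sqr_eq0 _ a b) => //.
have -> : r ^+ 2 = jacobi_op a b (P n) * r - l%:P * (P n * r).
  by rewrite expr2 {1}/r /l; ring.
rewrite wintB // wintC // wint_jacobi_op_sym //.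
by rewrite !orthogonal_low_degree ?size_jacobi_op // mulr0 subrr.
Qed.
End Orthogonal.

(** * The functional equation of Gamma *)

Section GammaRecurrence.
Local Open Scope classical_set_scope.
Local Open Scope ring_scope.
Variable R : realType.
Implicit Types (s c : R).

(** The absolute value makes the integrand continuous on the whole line for c >= 0. *)
Let f c (t : R) : R := `|t| `^ c * expR (- t).

Lemma continuous_gamma_integrand c : 0 <= c -> continuous (f c).
Proof.
move=> c0 t; apply: cvgM; last first.
  apply: (@continuous_comp _ _ _ (fun t : R => - t) (@expR R)).
    by apply: cvgN; exact: cvg_id.
  exact: continuous_expR.
move: c0; rewrite le_eqVlt => /predU1P[<-|c0]; last exact: continuous_normr_powR.
rewrite powRr0; under eq_fun do rewrite powRr0.
exact: cvg_cst.
Qed.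

Let I c : \bar R := (\int[lebesgue_measure]_(t in `]0%R, +oo[) (f c t)%:E)%E.
Let J c n : R := \int[lebesgue_measure]_(t in `[0%R, n%:R]) f c t.

Lemma GammaE s : Gamma s = fine (I (s - 1)).
Proof.
rewrite /Gamma /Rintegral /I; congr fine; apply: eq_integral => t.
by rewrite inE /= in_itv /= andbT => t0; rewrite /f gtr0_norm.
Qed.

Let integrable_f c n : 0 <= c ->
  lebesgue_measure.-integrable `[0%R, n%:R] (EFin \o f c).
Proof.
move=> c0; apply: continuous_compact_integrable; first exact: segment_compact.
by apply: continuous_subspaceT; exact: continuous_gamma_integrand.
Qed.

Lemma gamma_partial_cvg c : 0 <= c -> (J c n)%:E @[n --> \oo] --> I c.
Proof.
move=> c0.
have fi n : lebesgue_measure.-integrable `]0%R, n%:R] (EFin \o f c).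
  apply: integrableS (integrable_f n c0) => //.
  by move=> t /=; rewrite !in_itv /= => /andP[/ltW -> ->].
have mf n := measurable_int _ (fi n).
have JE n : (J c n)%:E =
    (\int[lebesgue_measure]_(t in `]0%R, (0 + n%:R)%R]) (f c t)%:E)%E.
  rewrite add0r (integral_itv_obnd_cbnd (mf n)) /J /Rintegral fineK //.
  by apply: integrable_fin_num => //; exact: integrable_f.
under eq_fun do rewrite JE.
rewrite /I (itv_bndy_bigcup_BRight false (0 : R)).
apply: ge0_nondecreasing_set_cvg_integral => //.
- move=> m n mn; apply/subsetPset => t /=; rewrite !in_itv /= => /andP[->] /=.
  by move=> /le_trans; apply; rewrite lerD2l ler_nat.
- by move=> n; rewrite add0r; exact: mf.
- by move=> n t _; rewrite lee_fin mulr_ge0 ?powR_ge0 ?expR_ge0.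
Qed.

Lemma powR_expRN_cvg0 s : (n%:R : R) `^ s * expR (- n%:R) @[n --> \oo] --> 0.
Proof.
apply/cvgrPdist_lt => e e0; pose k := (Num.truncn s).+1.
near=> n; rewrite sub0r normrN ger0_norm; last by rewrite mulr_ge0 ?powR_ge0 ?expR_ge0.
have n1 : 1 <= n%:R :> R by rewrite ler1n; near: n; exact: nbhs_infty_gt.
have n0 : 0 < n%:R :> R by lra.
have nk : n%:R `^ s <= n%:R ^+ k :> R.
  by rewrite -powR_mulrn ?ler0n // ler_powR // ltW // truncnS_gt.
have en : n%:R ^+ k.+1 / k.+1`!%:R <= expR n%:R :> R.
  by apply: le_trans (expR_ge1Dxn k (ltW n0)); rewrite lerDr.
have fk : 0 < k.+1`!%:R :> R by rewrite ltr0n fact_gt0.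
rewrite expRN ltr_pdivrMr ?expR_gt0 //.
apply: (le_lt_trans nk).
apply: (@lt_le_trans _ _ (e * (n%:R ^+ k.+1 / k.+1`!%:R))); last first.
  by rewrite ler_wpM2l // ltW.
rewrite mulrA ltr_pdivlMr // exprS mulrA [ltRHS]mulrC ltr_pM2l ?exprn_gt0 //.
rewrite mulrC -ltr_pdivrMr //.
by near: n; exact: nbhs_infty_gtr.
Unshelve. all: by end_near.
Qed.

Lemma gamma_partial_rec s n : 1 <= s -> (0 < n)%N ->
  J s n = s * J (s - 1) n - n%:R `^ s * expR (- n%:R).
Proof.
move=> s1 n0.
have s0 : 0 <= s - 1 by lra.
have nR : 0 < n%:R :> R by rewrite ltr0n.
rewrite /J -RintegralZl //; last exact: integrable_f.
rewrite -[LHS](subKr (\int[lebesgue_measure]_(t in `[0%R, n%:R]) (s * f (s - 1) t))).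
congr (_ - _); rewrite -RintegralB //; first last.
- by apply: integrable_f; lra.
- have := integrable_f n s0; move=> /(integrableZl _ s) H.
  by apply: H.
pose F (t : R) : R := t `^ s * expR (- t).
have FG t : 0 <= t -> F t = f s t by move=> t0; rewrite /F /f ger0_norm.
have cf : continuous (f s) by apply: continuous_gamma_integrand; lra.
have dF (t : R) : 0 < t -> is_derive t (1 : R) F (s * f (s - 1) t - f s t).
  move=> t0.
  have h1 : is_derive t (1 : R) (fun z : R => z `^ s) (s * t `^ (s - 1)).
    exact: is_derive1_powR.
  have h2 : is_derive t (1 : R) (fun z : R => expR (- z)) (- expR (- t)).
    have k1 : is_derive t (1 : R) (fun z : R => - z) (-1) by apply: trigger_derive.
    have := @is_derive1_comp _ (@expR R) (fun z : R => - z) t _ _ (is_derive_expR _) k1.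
    by rewrite mulrN1.
  apply: (trigger_derive (is_deriveM h1 h2)).
  by rewrite /f !gtr0_norm // /GRing.scale /=; ring.
rewrite /Rintegral (@continuous_FTC2 _ _ F) //=.
- rewrite /F powR0 ?mul0r ?subr0 //; lra.
- apply: continuous_subspaceT => t; apply: cvgB; last exact: cf.
  by apply: cvgMr; exact: continuous_gamma_integrand.
- have bnd (t : R) (E : set_system R) : Filter E -> E --> nbhs t ->
      (\forall u \near E, 0 <= u) -> 0 <= t -> F u @[u --> E] --> F t.
    move=> FE Et hE tt; rewrite FG //.
    have : f s u @[u --> E] --> f s t by apply: cvg_trans (cf t); exact: cvg_app.
    apply: cvg_trans; apply: near_eq_cvg.
    by apply: filterS hE => u /FG ->.
  split.
  + by move=> t; rewrite in_itv /= => /andP[t0 _]; have [] := dF t t0.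
  + by apply: bnd; [exact: cvg_within|exact: nbhs_right_ge|].
  + by apply: bnd; [exact: cvg_within|exact: nbhs_left_ge|exact: ltW].
- move=> t; rewrite in_itv /= => /andP[t0 _]; have [_] := dF t t0.
  by rewrite derive1E => ->.
Qed.

(** Integration by parts on [0, n], then the limit of both sides in the extended
    reals.  The limits agree whether or not they are finite, and so do their
    finite parts. *)
Lemma GammaS s : 1 <= s -> Gamma (s + 1) = s * Gamma s.
Proof.
move=> s1; rewrite !GammaE addrK.
have H : (J s n)%:E @[n --> \oo] --> (s%:E * I (s - 1) - 0%:E)%E.
  apply: (@cvg_trans _ ((s%:E * (J (s - 1) n)%:E -
      (n%:R `^ s * expR (- n%:R))%:E)%E @[n --> \oo])).
    apply: near_eq_cvg; near=> n.
    have n0 : (0 < n)%N by near: n; exact: nbhs_infty_gt.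
    by rewrite (gamma_partial_rec s1 n0) EFinB EFinM.
  apply: cvgeB; first by rewrite fin_num_adde_defl.
    by apply: cvgeZl => //; apply: gamma_partial_cvg; lra.
  by apply/cvg_EFin; [exact: nearW|exact: powR_expRN_cvg0].
have -> : I s = (s%:E * I (s - 1))%E.
  rewrite sube0 in H.
  have s0 : 0 <= s by lra.
  have hJ := gamma_partial_cvg s0.
  rewrite -(cvg_lim (@ereal_hausdorff R) H).
  by rewrite -(cvg_lim (@ereal_hausdorff R) hJ).
have : (0 <= I (s - 1))%E.
  by apply: integral_ge0 => t _; rewrite lee_fin mulr_ge0 ?powR_ge0 ?expR_ge0.
case: (I (s - 1)) => [r _ //| _|//].
by rewrite gt0_muley ?mulr0 // lte_fin; lra.
Unshelve. all: by end_near.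
Qed.
End GammaRecurrence.

(** * Counting singular values *)

Section Counting.
Local Open Scope sesquilinear_scope.
Variables (C : numClosedFieldType) (m n : nat) (A : 'M[C]_(m, n)).

Let M := A ^t* *m A.
Let P := spectralmx M.
Let lam i := spectral_diag M ord0 i.

Lemma gram_spectralE : M = P ^t* *m diag_mx (spectral_diag M) *m P.
Proof.
rewrite -invmx_unitary ?spectral_unitarymx //; apply/orthomx_spectralP.
by apply/normalmxP; rewrite /M !trmx_mul !map_mxM !trmxCK.
Qed.

Lemma gram_diag j : M j j = \sum_i `|A i j| ^+ 2.
Proof.
by rewrite mxE; apply: eq_bigr => i _; rewrite !mxE mulrC -normCK.
Qed.

Lemma gram_diag_spectral j : M j j = \sum_i lam i * `|P i j| ^+ 2.
Proof.
rewrite {1}gram_spectralE mul_mx_diag mxE; apply: eq_bigr => i _.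
by rewrite !mxE normCK mulrAC mulrC [P i j * _]mulrC.
Qed.

Lemma gram_eigenvalue_ge0 i : 0 <= lam i.
Proof.
have uP := spectral_unitarymx M.
have E : P *m M *m P ^t* = diag_mx (spectral_diag M).
  by rewrite {1}gram_spectralE !mulmxA mulmxtVK // (unitarymxP uP) mul1mx.
have -> : lam i = (P *m M *m P ^t*) i i by rewrite E mxE eqxx mulr1n.
have -> : P *m M *m P ^t* = (A *m P ^t*) ^t* *m (A *m P ^t*).
  by rewrite trmx_mul map_mxM trmxCK !mulmxA.
rewrite mxE sumr_ge0 // => k _.
by rewrite [_ ^t* _ _]mxE [_^T _ _]mxE mulrC -normCK exprn_ge0.
Qed.

Lemma spectral_row_norm i : \sum_j `|P i j| ^+ 2 = 1.
Proof.
have /unitarymxP/matrixP/(_ i i) := spectral_unitarymx M.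
rewrite !mxE eqxx -[true%:R]/(1 : C) => <-; apply: eq_bigr => j _.
by rewrite !mxE normCK.
Qed.

Lemma spectral_col_norm j : \sum_i `|P i j| ^+ 2 = 1.
Proof.
have : P ^t* *m P = 1%:M.
  by rewrite -invmx_unitary ?spectral_unitarymx // mulVmx // spectral_unit.
move/matrixP/(_ j j); rewrite !mxE eqxx -[true%:R]/(1 : C) => <-; apply: eq_bigr => i _.
by rewrite !mxE normCK mulrC.
Qed.

(** With M = A^* A = sum_i lam_i p_i^* p_i, the columns of index at least k have
    squared norm sum_(j >= k) M_jj = sum_i lam_i q_i, where q_i is the weight of the
    unit vector p_i on the indices j >= k.  Each q_i is one minus the weight on the
    indices j < k, and these weights add up to at most k over all i, the p_i being
    orthonormal. *)
Lemma count_large_eigenvalues (e : C) (k : nat) : 0 <= e ->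
  #|[set i | e <= lam i]|%:R * e <=
    k%:R * e + \sum_(j < n | (k <= j)%N) \sum_i `|A i j| ^+ 2.
Proof.
move=> e0; set I := [set i | _].
have -> : \sum_(j < n | (k <= j)%N) \sum_i `|A i j| ^+ 2 =
    \sum_i lam i * \sum_(j < n | (k <= j)%N) `|P i j| ^+ 2.
  under eq_bigr => j _ do rewrite -gram_diag gram_diag_spectral.
  by rewrite exchange_big; apply: eq_bigr => i _; rewrite mulr_sumr.
have q0 i : 0 <= \sum_(j < n | (k <= j)%N) `|P i j| ^+ 2.
  by apply: sumr_ge0 => j _; rewrite exprn_ge0.
apply: (@le_trans _ _ (k%:R * e +
    \sum_(i in I) e * \sum_(j < n | (k <= j)%N) `|P i j| ^+ 2)); last first.
  rewrite lerD2l [leRHS](bigID (mem I)) /= -[leLHS]addr0 lerD //.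
    by apply: ler_sum => i; rewrite inE => h; rewrite ler_wpM2r.
  by apply: sumr_ge0 => i _; rewrite mulr_ge0 ?gram_eigenvalue_ge0.
rewrite -mulr_sumr [k%:R * _]mulrC -mulrDr mulrC ler_wpM2l //.
rewrite -lerBlDl.
apply: (@le_trans _ _ (\sum_(i in I) (1 - \sum_(j < n | (j < k)%N) `|P i j| ^+ 2))).
  rewrite sumrB sumr_const lerB //.
  rewrite exchange_big /=.
  apply: (@le_trans _ _ (\sum_(j < n | (j < k)%N) (1%N)%:R)).
    apply: ler_sum => j _; rewrite -(spectral_col_norm j).
    rewrite [leRHS](bigID (mem I)) /= lerDl.
    by apply: sumr_ge0 => i _; rewrite exprn_ge0.
  rewrite -natr_sum ler_nat; have [kn|kn] := leqP k n.
    by rewrite (big_ord_narrow kn) sum1_card card_ord.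
  by rewrite sum1dep_card (leq_trans (max_card _)) // card_ord ltnW.
apply: ler_sum => i _; rewrite -(spectral_row_norm i).
rewrite (bigID (fun j : 'I_n => (j < k)%N)) /= addrAC subrr add0r.
by rewrite le_eqVlt; apply/orP; left; apply/eqP; apply: eq_bigl => j; rewrite -leqNgt.
Qed.
End Counting.

Section ZeroDistributed.
Local Open Scope sesquilinear_scope.
Local Open Scope classical_set_scope.

Lemma Cc_bounded (R : realType) (F : R -> Cplx R) : Cc F ->
  exists2 K : R, 0 < K & forall x, `|F x| <= real_complex R K.
Proof.
move=> [cF kF].
pose g (x : R) : R := complex.Re `|F x|.
have gE x : `|F x| = real_complex R (g x).
  by rewrite /g RRe_real // normr_real.
have cg : continuous g.
  move=> x; apply/cvgrPdist_lt => e e0.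
  have e0' : 0 < (real_complex R e : Cplx R) by rewrite ltcR.
  have /cvgrPdist_lt/(_ _ e0') := cF x; apply: filterS => y hy.
  rewrite -ltcR; apply: le_lt_trans hy.
  have -> : real_complex R `|g x - g y| = `| `|F x| - `|F y| |.
    rewrite 2!gE -rmorphB normc_def /= expr0n addr0 sqrtr_sqr //.
  exact: ler_dist_dist.
have kg : compact (g @` closure [set x | F x != 0]).
  by apply: continuous_compact => //; apply: continuous_subspaceT.
have [M [Mr HM]] := compact_bounded kg.
exists (`|M| + 1); first by rewrite ltr_pwDr.
move=> x; rewrite gE lecR.
have [Fx0|Fx0] := eqVneq (F x) 0.
  by rewrite /g Fx0 normr0 /= addr_ge0.
apply: le_trans (ler_norm _) _.
apply: (HM (`|M| + 1)).
  by rewrite (le_lt_trans (ler_norm _)) // ltrDl.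
by exists x => //; apply: subset_closure.
Qed.

Lemma singular_values_sum (R : realType) (m n : nat) (A : 'M[Cplx R]_(m, n))
    (F : R -> Cplx R) : (n <= m)%N ->
  \sum_(s <- singular_values A) F s =
  \sum_i F (Num.sqrt (complex.Re (spectral_diag (A ^t* *m A) ord0 i))).
Proof.
move=> nm; rewrite /singular_values take_oversize; last first.
  by rewrite size_sort size_map -cardE card_ord (minn_idPr nm).
by rewrite (perm_big _ (permEl (perm_sort _ _))) big_map big_enum.
Qed.

Lemma count_large_singular_values (R : realType) (m n : nat) (A : 'M[R]_(m, n))
    (e : R) (k : nat) : 0 < e ->
  #|[set i | e <= Num.sqrt (complex.Re (spectral_diag
      ((map_mx (real_complex R : R -> Cplx R) A) ^t* *m
        map_mx (real_complex R : R -> Cplx R) A) ord0 i))]%SET|%:R * e ^+ 2 <=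
  k%:R * e ^+ 2 + \sum_(j < n | (k <= j)%N) \sum_i A i j ^+ 2.
Proof.
move=> e0; set Z := map_mx _ A; set S := [set i | _]%SET.
have e2 : 0 <= (real_complex R (e ^+ 2) : Cplx R) by rewrite lecR sqr_ge0.
have := count_large_eigenvalues Z k e2.
have -> : [set i | real_complex R (e ^+ 2) <= spectral_diag (Z ^t* *m Z) ord0 i]%SET = S.
  apply/setP => i; rewrite !inE.
  have l0 := gram_eigenvalue_ge0 Z i.
  rewrite -[X in _ <= X]RRe_real ?ger0_real // lecR.
  rewrite -[in RHS](ger0_norm (ltW e0)) -sqrtr_sqr ler_sqrt //.
  by rewrite -ler0c RRe_real ?ger0_real.
have -> : \sum_(j < n | (k <= j)%N) \sum_i `|Z i j| ^+ 2 =
    real_complex R (\sum_(j < n | (k <= j)%N) \sum_i A i j ^+ 2).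
  rewrite rmorph_sum; apply: eq_bigr => j _; rewrite rmorph_sum.
  apply: eq_bigr => i _; rewrite mxE real_normK ?rmorphXn //.
  by rewrite complex_real.
have hn (q : nat) : q%:R = real_complex R q%:R :> Cplx R by rewrite rmorph_nat.
by rewrite !hn -!rmorphM -rmorphD lecR.
Qed.

(** The average of F (s_i) - F 0 is split into the singular values below e, where
    continuity at 0 applies, and the few others, where F is merely bounded. *)
Lemma zero_distributed_of_count (R : realType) (m n : nat -> nat)
    (Z : forall N, 'M[Cplx R]_(m N, n N)) :
  (forall N, n N <= m N)%N -> n @ \oo --> \oo ->
  (forall e d : R, 0 < e -> 0 < d -> \forall N \near \oo,
     #|[set i | e <= Num.sqrt
         (complex.Re (spectral_diag (Z N ^t* *m Z N) ord0 i))]%SET|%:R <=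
     d * (n N)%:R) ->
  zero_distributed Z.
Proof.
move=> nm noo H.
have mE N : minn (m N) (n N) = n N by apply/minn_idPr.
split; first by under eq_fun do rewrite mE.
move=> F HF; have [K K0 HK] := Cc_bounded HF.
under eq_fun do rewrite mE singular_values_sum //.
apply/cvgrPdist_le => e' e'0.
have [e e0 ->] : exists2 e : R, 0 < e & e' = real_complex R e.
  by exists (complex.Re e'); rewrite -?ltcR RRe_real // gtr0_real.
have e20 : 0 < (real_complex R (e / 2) : Cplx R) by rewrite ltcR divr_gt0.
have /cvgrPdist_lt/(_ _ e20) := HF.1 (0 : R).
rewrite near_simpl => /nbhs_ballP[e1 /= e10 He1].
have d0 : 0 < e / (4 * K) by rewrite divr_gt0 // mulr_gt0.
have n0 : \forall N \near \oo, (0 < n N)%N := noo _ (nbhs_infty_gt 0).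
near=> N.
have nN : (0 < n N)%N by near: N.
have HI : #|[set i | e1 <= Num.sqrt
    (complex.Re (spectral_diag (Z N ^t* *m Z N) ord0 i))]%SET|%:R <=
    e / (4 * K) * (n N)%:R by near: N; exact: H.
pose s i : R := Num.sqrt (complex.Re (spectral_diag (Z N ^t* *m Z N) ord0 i)).
rewrite -[X in _ * X]/(\sum_i F (s i)).
set I : {set _} := [set i | e1 <= s i]%SET.
rewrite -/I in HI.
have nC : ((n N)%:R : Cplx R) != 0 by rewrite pnatr_eq0 -lt0n.
have -> : F 0 - (n N)%:R^-1 * \sum_i F (s i) =
    (n N)%:R^-1 * \sum_i (F 0 - F (s i)).
  by rewrite sumrB sumr_const card_ord mulrBr -[F 0 *+ _]mulr_natl mulKf.
rewrite normrM normfV normr_nat ler_pdivrMl ?ltr0n //.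
apply: le_trans (ler_norm_sum _ _ _) _.
rewrite (bigID (mem I)) /=.
apply: (@le_trans _ _ (\sum_(i in I) real_complex R (2 * K) +
    \sum_(i < n N | i \notin I) real_complex R (e / 2))).
  apply: lerD; apply: ler_sum => i.
    move=> _; apply: le_trans (ler_normB _ _) _.
    by rewrite mulr_natl mulr2n rmorphD lerD.
  rewrite inE -ltNge => si; apply/ltW/He1.
  by rewrite /ball /= sub0r normrN ger0_norm // sqrtr_ge0.
rewrite sumr_const.
apply: (@le_trans _ _ (real_complex R (2 * K) *+ #|I| +
    \sum_(i < n N) real_complex R (e / 2))).
  rewrite lerD2l [leRHS](bigID (mem I)) /= lerDr.
  by apply: sumr_ge0 => i _; apply: ltW.
have hn : (n N)%:R = real_complex R (n N)%:R :> Cplx R by rewrite rmorph_nat.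
rewrite sumr_const card_ord hn -!rmorphMn -rmorphD -rmorphM lecR -[2 * K *+ _]mulr_natl -[e / 2 *+ _]mulr_natl.
have K20 : 0 <= 2 * K by rewrite mulr_ge0 // ltW.
have := ler_wpM2r K20 HI.
have -> : e / (4 * K) * (n N)%:R * (2 * K) = (n N)%:R * (e / 2).
  by field; rewrite gt_eqF.
lra.
Unshelve. all: by end_near.
Qed.
End ZeroDistributed.

(** * The uniform bound and the zero distribution *)

(** Sonin's bound and the estimate at 0 together; the normalization enters through
    the ratio of the values at 1. *)
Lemma is_jacobi_bound (R : realType) (a b : R) (P : nat -> {poly R}) :
  1 / 2 <= a -> 1 / 2 <= b -> is_jacobi a b P ->
  exists2 K : R, 0 <= K & forall n x, -1 <= x <= 1 ->
    ((P n).[x] * jacobi_weight a b x) ^+ 2 <= K / n.+1%:R.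
Proof.
move=> ha hb [sP oP P1].
have a0 : 0 < a by lra.
have b0 : 0 < b by lra.
have orth i j : i <> j -> wint a b (P i * P j) = 0.
  move=> /oP <-; apply: eq_Rintegral => t _; by rewrite hornerM.
have eig := orthogonal_jacobi_op a0 b0 sP orth.
have P1S n : n.+1%:R * (P n.+1).[1] = (n.+1%:R + a) * (P n).[1].
  have n1 : (1 : R) <= n.+1%:R by rewrite ler1n.
  have na : 1 <= n.+1%:R + a by lra.
  have e1 : n%:R + 1 = n.+1%:R :> R by rewrite natr1.
  have e2 : n%:R + a + 1 = n.+1%:R + a by rewrite -e1 addrAC.
  rewrite !P1 (GammaS n1) (GammaS na) e1 e2.
  move: (Gamma _) (Gamma _) (Gamma _) => G1 G2 G3.
  have h : n.+1%:R * n.+1%:R^-1 = 1 :> R by rewrite mulfV // gt_eqF // ltr0Sn.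
  rewrite !invfM; move: n.+1%:R n.+1%:R^-1 h => A A' h.
  transitivity ((A * A') * ((A + a) * (G3 * (G2^-1 * G1^-1)))); first ring.
  by rewrite h mul1r.
have [K K0 HK] := jacobi_energy_at0 ha hb eig P1S.
set p := 2 `^ (2 * a - 1) + 2 `^ (2 * b - 1).
have p0 : 0 <= p by rewrite addr_ge0 ?powR_ge0.
exists (p * K); first exact: mulr_ge0.
move=> n x hx.
have L0 : 0 < n.+1%:R * (n%:R + a + b).
  by have := ler0n R n; move=> n0; rewrite mulr_gt0 ?ltr0Sn //; lra.
apply: le_trans (jacobi_weight_bound ha hb L0 _ hx) _.
  by rewrite eig; congr (_%:P * _); rewrite -natr1; ring.
by rewrite -mulrA ler_wpM2l.
Qed.

Section NearPower.
Local Open Scope classical_set_scope.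

Lemma near_natr_powR_lt (R : realType) (c e : R) : c < 0 -> 0 < e ->
  \forall N \near \oo, (N%:R : R) `^ c < e.
Proof.
move=> c0 e0; near=> N.
have N0 : 0 < N%:R :> R by rewrite ltr0n; near: N; exact: nbhs_infty_gt.
have r0 : 0 < - c by rewrite oppr_gt0.
rewrite -(opprK c) powRN invf_plt ?posrE ?powR_gt0 //.
have -> : e^-1 = (e^-1 `^ (- c)^-1) `^ (- c).
  by rewrite -powRrM mulVf ?gt_eqF // powRr1 // invr_ge0 ltW.
rewrite gt0_ltr_powR ?nnegrE ?powR_ge0 ?ler0n //.
by near: N; exact: nbhs_infty_gtr.
Unshelve. all: by end_near.
Qed.

End NearPower.

Theorem proposition4p1 (R : realType) (g a b : R) (P : nat -> {poly R})
    (x : forall N : nat, 'I_N.+1 -> R)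
    (hg : g < 1) (ha : 1 / 2 <= a) (hb : 1 / 2 <= b)
    (hP : is_jacobi a b P)
    (hx0 : forall N : nat, (0 < N)%N -> x N ord0 = -1)
    (hxN : forall N : nat, (0 < N)%N -> x N ord_max = 1)
    (hx : forall N : nat, (0 < N)%N ->
       forall k l : 'I_N.+1, (k < l)%N -> x N k < x N l) :
  zero_distributed (fun N : nat =>
    map_mx (real_complex R : R -> Cplx R)
      (N%:R `^ g *: jacobi_matrix a b P (x N))).
Proof.
have [K K0 HK] := is_jacobi_bound ha hb hP.
apply: zero_distributed_of_count => [N| |e d e0 d0]; [exact: leqnSn|exact: cvg_id|].
have e20 : 0 < e ^+ 2 by rewrite exprn_gt0.
have c0 : 2 * g - 2 < 0 by lra.
(* the level of N^(2g-2) at which the tail takes at most half of d N *)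
pose c := d ^+ 4 * e ^+ 2 / (128 * (K + 1)).
have cp : 0 < c by rewrite !(divr_gt0, mulr_gt0) ?exprn_gt0 //; lra.
have Hc := near_natr_powR_lt c0 cp.
near=> N.
have N0 : (0 < N)%N by near: N; exact: nbhs_infty_gt.
have NR : 1 <= N%:R :> R by rewrite ler1n.
have hN : N%:R `^ (2 * g - 2) < c by near: N; exact: Hc.
have xN i : -1 <= x N i <= 1.
  have xle (k l : 'I_N.+1) : (k <= l)%N -> x N k <= x N l.
    rewrite leq_eqVlt => /predU1P[/val_inj -> //|kl].
    exact/ltW/(hx N N0).
  apply/andP; split; [rewrite -(hx0 N N0)|rewrite -(hxN N N0)]; apply: xle => //.
  by rewrite -ltnS ltn_ord.
(* the columns before k are counted, those from k on are small *)
pose k := Num.truncn (d * N%:R / 2).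
have dN : 0 < d * N%:R / 2 by rewrite divr_gt0 // mulr_gt0 //; lra.
have kle : k%:R <= d * N%:R / 2 by rewrite truncn_le // ltW.
have kgt : d * N%:R / 2 < k.+1%:R by apply: truncnS_gt.
rewrite -(ler_pM2r e20).
apply: le_trans (count_large_singular_values _ k e0) _.
set A := _ *: _.
set D := d * N%:R / 2 in dN kle kgt *.
pose B := N%:R `^ (2 * g) * (4 * K) / D ^+ 3.
have B0 : 0 <= B.
  by rewrite /B divr_ge0 ?exprn_ge0 ?(ltW dN) // mulr_ge0 ?powR_ge0 // mulr_ge0.
have AB (i : 'I_N.+1) (j : 'I_N) : (k <= j)%N -> A i j ^+ 2 <= B.
  move=> kj; rewrite !mxE.
  have t1 : (1 : R) <= j.+1%:R by rewrite ler1n.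
  have Dj : D <= j.+1%:R by apply: le_trans (ltW kgt) _; rewrite ler_nat.
  have Dj2 : D <= j.+2%:R by apply: le_trans Dj _; rewrite ler_nat.
  have j2 : 0 < j.+2%:R :> R by rewrite ltr0Sn.
  rewrite -[2 / _ * _ * _]mulrA 2!exprMn.
  rewrite -[(N%:R `^ g) ^+ 2]powR_mulrn ?powR_ge0 // -powRrM [g * _]mulrC.
  have -> : B = N%:R `^ (2 * g) * ((2 / D) ^+ 2 * (K / D)).
    by rewrite /B; field; rewrite gt_eqF.
  rewrite ler_wpM2l ?powR_ge0 //; apply: ler_pM; rewrite ?sqr_ge0 //.
    have m0 : 0 < j.+1%:R + a + b + 1 by lra.
    have p1 : 0 <= 2 / D by apply: divr_ge0 (ltW dN).
    have p2 : 0 <= 2 / (j.+1%:R + a + b + 1) by apply: divr_ge0 (ltW m0).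
    rewrite ler_pXn2r ?nnegrE //.
    by rewrite ler_wpM2l // lef_pV2 ?posrE //; lra.
  apply: le_trans (HK j.+1 _ (xN i)) _.
  by rewrite ler_wpM2l // lef_pV2 ?posrE.
have BS : \sum_(j < N | (k <= j)%N) \sum_i A i j ^+ 2 <= N%:R * (N.+1%:R * B).
  apply: (@le_trans _ _ (\sum_(j < N) \sum_(i < N.+1) B)).
    rewrite [leRHS](bigID (fun j : 'I_N => (k <= j)%N)) /= -[leLHS]addr0 lerD //.
      by apply: ler_sum => j kj; apply: ler_sum => i _; exact: AB.
    by apply: sumr_ge0 => j _; apply: sumr_ge0.
  by rewrite !sumr_const !card_ord !mulr_natl.
apply: le_trans (lerD (ler_wpM2r (ltW e20) kle) BS) _.
have NN : N.+1%:R <= 2 * N%:R :> R by rewrite -natr1; lra.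
have E1 : N%:R `^ (2 * g) = N%:R `^ (2 * g - 2) * N%:R ^+ 2.
  rewrite -powR_mulrn ?ler0n // -powRD ?subrK //.
  by rewrite pnatr_eq0 -lt0n N0 implybT.
have : N%:R * (N.+1%:R * B) <= N%:R * (2 * N%:R * B).
  by rewrite ler_wpM2l // ler_wpM2r.
have -> : N%:R * (2 * N%:R * B) =
    (N%:R `^ (2 * g - 2) * (K + 0)) * (64 * N%:R / d ^+ 3).
  rewrite /B E1 /D; field; rewrite gt_eqF //=; lra.
have : N%:R `^ (2 * g - 2) * (K + 0) <= c * (K + 1).
  by apply: ler_pM; rewrite ?powR_ge0 ?addr0 ?(ltW hN) // lerDl.
have -> : c * (K + 1) = d ^+ 4 * e ^+ 2 / 128 by rewrite /c; field; rewrite gt_eqF //; lra.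
move: (_ * (K + 0)) => u hu.
have q0 : 0 <= 64 * N%:R / d ^+ 3 by rewrite divr_ge0 ?mulr_ge0 ?exprn_ge0 // ltW.
have := ler_wpM2r q0 hu.
have -> : d ^+ 4 * e ^+ 2 / 128 * (64 * N%:R / d ^+ 3) = d * N%:R * e ^+ 2 / 2.
  by field; rewrite gt_eqF.
rewrite /D; lra.
Unshelve. all: by end_near.
Qed.
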